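(* Let $(\Gamma,S)$ be a Hecke pair in a group $G$, let $X$ be a set with a right action of $G$, let $W=\bigoplus_{x\in X}W_x$ be an $S$-sheaf on $X$, and let $F$ be a right $S$-module. Let $A\subset X$ be a set of representatives of the $\Gamma$-orbits of $X$. Let $$\lambda: W\otimes_\Gamma F\to\bigoplus_{a\in A}W_a\otimes_{\Gamma_a}F$$ be the natural isomorphism, which for $a\in A$, $\gamma\in\Gamma$, $w\in W_{a\gamma}$, $f\in F$ sends the class of $w\otimes f$ to the class of $w\gamma^{-1}\otimes f\gamma^{-1}$ in $W_a\otimes_{\Gamma_a}F$. Then for every $h\in\mathcal H(\Gamma,S)$ the Hecke operator $T_h$ on $W\otimes_\Gamma F$ corresponds under $\lambda$ to the matrix of operators $(T_{ab})_{a,b\in A}$; that is, for all $z\in W\otimes_\Gamma F$ and $b\in A$, the $b$-component of $\lambda(z|T_h)$ is $\sum_{a\in A}\lambda(z)_a|T_{ab}$. Moreover, if $F$ is a resolution of $\mathbb Z$ by projective $\mathbb Z[\Gamma]$-modules which are also $S$-modules (with $S$-equivariant maps), then $\lambda$ induces the isomorphism on homology given by Shapiro's lemma, $$H_q(\Gamma,W)\cong\bigoplus_{a\in A}H_q(\Gamma_a,W_a),$$ and under it $T_h$ on the left again corresponds to the matrix $(T_{ab})$ on the right.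
   Context: A Hecke pair $(\Gamma,S)$ in $G$ is a subgroup $\Gamma\subset G$ and a subsemigroup $S\subset G$ with $\Gamma\subset S$ such that for every $s\in S$ both $\Gamma\cap s^{-1}\Gamma s$ and $s\Gamma s^{-1}\cap\Gamma$ have finite index in $\Gamma$. $\mathcal H(\Gamma,S)$ is the set of ($\mathbb Z$-valued) functions on $S$ that are left and right $\Gamma$-invariant and supported on finitely many double cosets $\Gamma s\Gamma$. For $x\in X$, $\Gamma_x$ is the stabilizer of $x$ in $\Gamma$. An $S$-sheaf $W$ on $X$ consists of an abelian group $W_x$ for each $x\in X$ and homomorphisms $\mu(g):W_x\to W_{xg}$ for all $g\in S$, $x\in X$, with $\mu(h)\circ\mu(g)=\mu(gh)$ and $\mu(1)=\mathrm{id}$. Then $W=\bigoplus_xW_x$ is a right $\mathbb Z[S]$-module; write $wg=\mu(g)(w)$. $W\otimes F$ (tensor over $\mathbb Z$) is a right $S$-module by $(w\otimes f)g=wg\otimes fg$. For a group $K$ and right $\mathbb Z[K]$-modules $M,M'$, $M\otimes_KM'$ denotes the coinvariants of $M\otimes M'$ under the diagonal right $K$-action. For $h\in\mathcal H(\Gamma,S)$, the Hecke operator $T_h$ on $W\otimes_\Gamma F$ sends the class of $z\in W\otimes F$ to the class of $\sum_{g}h(g)\,zg$, the sum being over representatives $g$ of the cosets $g\Gamma$ in $S$. For $a,b\in A$ define $h_{ab}:S\to\mathbb Z$ by $h_{ab}(g)=h(g)$ if $ag=b$ and $h_{ab}(g)=0$ otherwise; it is left $\Gamma_a$-invariant and right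 $\Gamma_b$-invariant. $T_{ab}:W_a\otimes_{\Gamma_a}F\to W_b\otimes_{\Gamma_b}F$ is the operator sending the class of $w\otimes f$ to the class of $\sum_t h_{ab}(t)\,wt\otimes ft$, the sum being over representatives $t$ of the cosets $t\Gamma_b$ in $S$. When $F$ is a complex, these operators are applied degreewise and commute with the boundary maps, hence act on homology. *)

(* Defs.v *)
From HB Require Import structures.
From mathcomp Require Import all_boot all_order all_algebra.
From mathcomp Require Import finmap boolp classical_sets cardinality fsbigop.
From mathcomp.multinomials Require Import freeg.

Set Implicit Arguments.
Unset Strict Implicit.
Unset Printing Implicit Defensive.

Import GRing.Theory.

Local Open Scope classical_set_scope.
Local Open Scope quotient_scope.
Local Open Scope ring_scope.

Section Quotient.
Variables (V : zmodType) (P : set V).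

Definition in_gensub (v : V) : Prop :=
  forall Q : set V, Q 0 -> (forall x y, Q x -> Q y -> Q (x - y)) ->
  P `<=` Q -> Q v.

Definition gensub : {pred V} := fun v => `[< in_gensub v >].

Fact gensub_zmod : zmod_closed gensub.
Proof.
split=> [|x y /asboolP hx /asboolP hy]; apply/asboolP => Q Q0 QB PQ //.
by apply: (QB); [exact: hx | exact: hy].
Qed.

HB.instance Definition _ := GRing.isZmodClosed.Build V gensub gensub_zmod.

Definition quotg := Quotient.quot gensub.
HB.instance Definition _ := GRing.Zmodule.on quotg.

Definition cls (v : V) : quotg := \pi_(Quotient.quot gensub) v.

Fact cls_is_zmod_morphism : zmod_morphism cls.
Proof. exact: (raddfB \pi_(Quotient.quot gensub)). Qed.

HB.instance Definition _ :=
  GRing.isZmodMorphism.Build V quotg cls cls_is_zmod_morphism.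

Lemma cls_surj (c : quotg) : exists v, c = cls v.
Proof. by exists (repr c); rewrite /cls reprK. Qed.

Lemma cls_eq0 v : cls v = 0 <-> in_gensub v.
Proof.
have -> : (cls v = 0) = (v \in gensub) :> Prop.
  rewrite -[v in RHS]subr0 Quotient.idealrBE; apply/propext.
  by split=> [h|/eqP]; [apply/eqP; rewrite -/(cls v) h -(raddf0 cls)
    | rewrite -/(cls v) -/(cls 0) raddf0].
by split=> /asboolP.
Qed.

Lemma cls_rel v : P v -> cls v = 0.
Proof. by move=> Pv; apply/cls_eq0 => Q _ _; apply. Qed.

End Quotient.

Section QuotientMap.
Variables (V : zmodType) (P : set V) (V' : zmodType) (P' : set V').

Definition descends (f : V -> V') : Prop := forall v, P v -> cls P' (f v) = 0.

(* The homomorphism induced on quotients, [cls v |-> cls (f v)]; it is set to 0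
   if [f] does not respect the relations (see [qmapE]). *)
Definition qmap (f : {additive V -> V'}) (c : quotg P) : quotg P' :=
  if `[< descends f >] then cls P' (f (repr c)) else 0.

Lemma qmapE (f : {additive V -> V'}) v :
  descends f -> qmap f (cls P v) = cls P' (f v).
Proof.
move=> fd; rewrite /qmap asboolT //.
apply/eqP; rewrite -subr_eq0 -!raddfB; apply/eqP.
have : cls P (repr (cls P v) - v) = 0.
  by rewrite raddfB /= {1}/cls reprK subrr.
move/cls_eq0 => /(_ [set v | cls P' (f v) = 0]); apply => /=.
- by rewrite (raddf0 f) raddf0.
- by move=> x y; rewrite /= (raddfB f) raddfB /= => -> ->; rewrite subr0.
- exact: fd.
Qed.

Fact qmap_is_zmod_morphism f : zmod_morphism (qmap f).
Proof.
move=> c d; have [v ->] := cls_surj c; have [w ->] := cls_surj d.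
rewrite -raddfB; case: (pselect (descends f)) => [fd|nfd].
  by rewrite !qmapE // !raddfB.
by rewrite /qmap asboolF // subr0.
Qed.

HB.instance Definition _ f :=
  GRing.isZmodMorphism.Build _ _ (qmap f) (qmap_is_zmod_morphism f).

End QuotientMap.

Arguments qmap {V} P {V'} P' f c.

Section DirectSum.
Variables (I : choiceType) (V : I -> zmodType).

Record dsum := DSum {
  dsum_fun :> forall i, V i;
  dsum_fin : finite_set [set i | dsum_fun i != 0] }.

HB.instance Definition _ := gen_eqMixin dsum.
HB.instance Definition _ := gen_choiceMixin dsum.

Lemma dsumP (v w : dsum) : (forall i, v i = w i) -> v = w.
Proof.
case: v w => [v hv] [w hw] /= vw.
have e : v = w by apply: functional_extensionality_dep.
by rewrite -e in hw *; congr DSum; apply: Prop_irrelevance.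
Qed.

Fact dsum_zero_fin : finite_set [set i | (0 : V i) != 0].
Proof.
by rewrite (_ : [set i | _] = set0) // -subset0 => i /=; rewrite eqxx.
Qed.
Definition dsum_zero := DSum dsum_zero_fin.

Fact dsum_opp_fin (v : dsum) : finite_set [set i | - v i != 0].
Proof.
by apply: sub_finite_set (dsum_fin v) => i /=; rewrite oppr_eq0.
Qed.
Definition dsum_opp v := DSum (dsum_opp_fin v).

Fact dsum_add_fin (v w : dsum) : finite_set [set i | v i + w i != 0].
Proof.
apply: sub_finite_set (_ : finite_set ([set i | v i != 0] `|` [set i | w i != 0])).
  move=> i /= h; apply/orP; apply: contraNT h.
  by rewrite negb_or !negbK => /andP[/eqP-> /eqP->]; rewrite addr0.
by rewrite finite_setU; split; exact: dsum_fin.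
Qed.
Definition dsum_add v w := DSum (dsum_add_fin v w).

Fact dsum_addA : associative dsum_add.
Proof. by move=> u v w; apply: dsumP => i /=; rewrite addrA. Qed.
Fact dsum_addC : commutative dsum_add.
Proof. by move=> u v; apply: dsumP => i /=; rewrite addrC. Qed.
Fact dsum_add0 : left_id dsum_zero dsum_add.
Proof. by move=> u; apply: dsumP => i /=; rewrite add0r. Qed.
Fact dsum_addN : left_inverse dsum_zero dsum_opp dsum_add.
Proof. by move=> u; apply: dsumP => i /=; rewrite addNr. Qed.

HB.instance Definition _ :=
  GRing.isZmodule.Build dsum dsum_addA dsum_addC dsum_add0 dsum_addN.

Fact dsum_in_fin i (v : V i) :
  finite_set [set j | eqtype.dfwith (fun j => 0 : V j) v j != 0].
Proof.
apply: sub_finite_set (finite_set1 i) => j /=.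
have [->//|ij] := eqVneq j i.
by rewrite eqtype.dfwith_out ?eqxx // eq_sym.
Qed.

Definition dsum_in i (v : V i) : dsum := DSum (dsum_in_fin v).

Lemma dsum_in_same i (v : V i) : dsum_in v i = v.
Proof. exact: eqtype.dfwith_in. Qed.

Lemma dsum_in_diff i (v : V i) j : i != j -> dsum_in v j = 0.
Proof. exact: eqtype.dfwith_out. Qed.

Fact dsum_in_is_zmod_morphism i : zmod_morphism (@dsum_in i).
Proof.
move=> v w; apply: dsumP => j; change (dsum_in (v - w) j = dsum_in v j - dsum_in w j).
have [<-|ij] := eqVneq i j; first by rewrite !dsum_in_same.
by rewrite !dsum_in_diff // subr0.
Qed.

HB.instance Definition _ i :=
  GRing.isZmodMorphism.Build _ _ (@dsum_in i) (@dsum_in_is_zmod_morphism i).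

Definition dsum_proj i (v : dsum) : V i := v i.
Fact dsum_proj_is_zmod_morphism i : zmod_morphism (@dsum_proj i).
Proof. by []. Qed.
HB.instance Definition _ i :=
  GRing.isZmodMorphism.Build _ _ (@dsum_proj i) (@dsum_proj_is_zmod_morphism i).

Section Lift.
Variables (U : zmodType) (f : forall i, {additive V i -> U}).

Definition dsum_lift (v : dsum) : U := \sum_(i \in [set: I]) f i (v i).

Lemma dsum_liftE (v : dsum) (B : set I) : finite_set B ->
  (forall i, v i != 0 -> B i) -> dsum_lift v = \sum_(i <- fset_set B) f i (v i).
Proof.
move=> Bfin vB; rewrite /dsum_lift -fsbig_finite //; apply/esym/fsbig_widen => //.
move=> i [_ nB]; rewrite /preimage /=; have [->|/vB/nB//] := eqVneq (v i) 0.
exact: raddf0.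
Qed.

Fact dsum_lift_is_zmod_morphism : zmod_morphism dsum_lift.
Proof.
move=> v w.
pose B := [set i | v i != 0] `|` [set i | w i != 0].
have Bfin : finite_set B by rewrite finite_setU; split; exact: dsum_fin.
rewrite !(@dsum_liftE _ B) //; [|by right|by left|].
  by rewrite -sumrB; apply: eq_bigr => i _; exact: raddfB.
move=> i; change (v i - w i != 0 -> B i) => h.
apply/orP; apply: contraNT h; rewrite negb_or !negbK.
by move=> /andP[/eqP-> /eqP->]; rewrite subr0.
Qed.

HB.instance Definition _ :=
  GRing.isZmodMorphism.Build _ _ dsum_lift dsum_lift_is_zmod_morphism.

Lemma dsum_lift_in i (v : V i) : dsum_lift (dsum_in v) = f i v.
Proof.
rewrite (@dsum_liftE _ [set i]) //.
  by rewrite fset_set1 big_seq_fset1 dsum_in_same.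
by move=> j; have [<-//|ij] := eqVneq i j; rewrite dsum_in_diff ?eqxx.
Qed.

End Lift.

Lemma dsum_liftK (v : dsum) : dsum_lift (@dsum_in) v = v.
Proof.
apply: dsumP => j.
rewrite (@dsum_liftE _ _ v ([set i | v i != 0] `|` [set j])); last by left.
  rewrite -/(dsum_proj j _) raddf_sum (bigD1_seq j) ?fset_uniq //=.
    rewrite eqtype.dfwith_in big1 ?addr0 // => i ij.
    by rewrite eqtype.dfwith_out.
  rewrite in_fset_set; first by rewrite inE; right.
  by rewrite finite_setU; split; [exact: dsum_fin|exact: finite_set1].
by rewrite finite_setU; split; [exact: dsum_fin|exact: finite_set1].
Qed.

Lemma dsum_ext (U : zmodType) (f g : {additive dsum -> U}) :
  (forall i (v : V i), f (dsum_in v) = g (dsum_in v)) -> f =1 g.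
Proof.
move=> fg v; rewrite -(dsum_liftK v) (dsum_liftE _ (dsum_fin v)) //.
by rewrite !raddf_sum; apply: eq_bigr => i _; exact: fg.
Qed.

End DirectSum.

Arguments dsum {I} V.
Arguments dsum_in {I V i} v.

Section Tensor.
Variables M N : zmodType.

Definition tensor_rel : set {freeg (M * N) / int} :=
  [set r | exists m m' n, r = << (m + m', n) >> - << (m, n) >> - << (m', n) >>]
  `|` [set r | exists m n n', r = << (m, n + n') >> - << (m, n) >> - << (m, n') >>].

Definition tensor := quotg tensor_rel.
HB.instance Definition _ := GRing.Zmodule.on tensor.

Definition tens (m : M) (n : N) : tensor := cls tensor_rel << (m, n) >>.

Lemma tensDl m m' n : tens (m + m') n = tens m n + tens m' n.
Proof.
apply/eqP; rewrite -subr_eq0 opprD addrA -!raddfB; apply/eqP/cls_rel.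
by left; exists m, m', n.
Qed.

Lemma tensDr m n n' : tens m (n + n') = tens m n + tens m n'.
Proof.
apply/eqP; rewrite -subr_eq0 opprD addrA -!raddfB; apply/eqP/cls_rel.
by right; exists m, n, n'.
Qed.

Lemma tensor_ind (Q : tensor -> Prop) : Q 0 ->
  (forall x y, Q x -> Q y -> Q (x - y)) -> (forall m n, Q (tens m n)) ->
  forall t, Q t.
Proof.
move=> Q0 QB Qt t; have [r ->] := cls_surj t.
have QN x : Q x -> Q (- x) by rewrite -sub0r => ?; apply: QB.
have QD x y : Q x -> Q y -> Q (x + y).
  by rewrite -{2}[y]opprK => ? ?; apply: QB => //; apply: QN.
rewrite -(freeg_sumE r) raddf_sum; elim/big_rec: _ => //= -[m n] x _ Qx.
apply: (QD) => //; set k := coeff _ _.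
rewrite -[k]intz -freegU_mulz raddfMz -/(tens m n).
have Qn j : Q (tens m n *+ j) by elim: j => // j IH; rewrite mulrS; apply: (QD).
by case: k => j; [|apply: (QN)]; apply: Qn.
Qed.

Lemma tensor_ext (U : zmodType) (f g : {additive tensor -> U}) :
  (forall m n, f (tens m n) = g (tens m n)) -> f =1 g.
Proof.
move=> fg; apply: tensor_ind => // [|x y fx fy]; first by rewrite !raddf0.
by rewrite !raddfB fx fy.
Qed.

End Tensor.

Section TensorMap.
Variables (M N M' N' : zmodType) (f : {additive M -> M'}) (g : {additive N -> N'}).

Definition tens_premap (r : {freeg (M * N) / int}) : {freeg (M' * N') / int} :=
  fglift (fun p : M * N => << (f p.1, g p.2) >>) r.

Fact tens_premap_is_zmod_morphism : zmod_morphism tens_premap.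
Proof. exact: lift_is_additive. Qed.

HB.instance Definition _ := GRing.isZmodMorphism.Build _ _ tens_premap
  tens_premap_is_zmod_morphism.

Definition tens_map : tensor M N -> tensor M' N' :=
  qmap (@tensor_rel M N) (@tensor_rel M' N') tens_premap.

HB.instance Definition _ := GRing.Additive.on tens_map.

Lemma tens_mapE m n : tens_map (tens m n) = tens (f m) (g n).
Proof.
have preU p : tens_premap << p >> = << (f p.1, g p.2) >>.
  by rewrite /tens_premap liftU scale1r.
rewrite /tens_map [LHS]qmapE /= ?preU //.
move=> _ [[m1 [m2 [n1 ->]]]|[m1 [n1 [n2 ->]]]];
  rewrite 2!(raddfB tens_premap) /= !preU /= ?(raddfD f) ?(raddfD g);
  apply: cls_rel.
  by left; do 3 eexists.
by right; do 3 eexists.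
Qed.

End TensorMap.

Section Groups.
Variable G : groupType.

Definition subgroup (H : set G) : Prop :=
  [/\ H 1%g, forall x y, H x -> H y -> H (x * y)%g & forall x, H x -> H x^-1%g].

Definition subsemigroup (S : set G) : Prop :=
  forall x y, S x -> S y -> S (x * y)%g.

Definition left_coset (x : G) (H : set G) : set G := [set (x * k)%g | k in H].

Definition double_coset (H : set G) (x : G) : set G :=
  [set (k * x * l)%g | k in H & l in H].

(* [H] is understood to be a subgroup of [K]. *)
Definition finite_index (H K : set G) : Prop :=
  finite_set [set left_coset x H | x in K].

Definition hecke_pair (Gam S : set G) : Prop :=
  [/\ subgroup Gam, subsemigroup S, Gam `<=` S &
      forall s, S s ->
        finite_index (Gam `&` [set (s^-1 * k * s)%g | k in Gam]) Gam /\
        finite_index ([set (s * k * s^-1)%g | k in Gam] `&` Gam) Gam].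

(* An element of the Hecke algebra is a function on [S], encoded by its
   extension by zero to [G]. *)
Definition hecke_fun (Gam S : set G) (h : G -> int) : Prop :=
  [/\ forall g, ~ S g -> h g = 0,
      forall k g, Gam k -> S g -> h (k * g)%g = h g,
      forall k g, Gam k -> S g -> h (g * k)%g = h g &
      finite_set [set double_coset Gam g | g in [set g | S g /\ h g != 0]]].

Definition is_coset_reps (K S R : set G) : Prop :=
  R `<=` S /\ forall g, S g -> exists! r, R r /\ left_coset r K g.

Definition coset_rep (K : set G) (g : G) : G := xget 1%g (left_coset g K).

Definition coset_reps (K S : set G) : set G := coset_rep K @` S.

Record gset := GSet {
  gset_sort :> choiceType;
  gact : gset_sort -> G -> gset_sort;
  gact1 : forall x, gact x 1%g = x;
  gactM : forall x g h, gact (gact x g) h = gact x (g * h)%g }.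

Definition stab (Gam : set G) (X : gset) (x : X) : set G :=
  [set g | Gam g /\ gact x g = x].

Definition orbit_reps (Gam : set G) (X : gset) (A : set X) : Prop :=
  forall x : X, exists! a, A a /\ exists2 k, Gam k & x = gact a k.

(* An abelian group with a right operation of the elements of [G]. Being a
   right [Z[K]]-module, for [K] a submonoid of [G], is the predicate
   [is_right_module K]; operations of elements outside [K] are irrelevant. In
   this way a right module over [S] is also one over the submonoids of [S]. *)
Record opmod := OpMod {
  opmod_sort :> zmodType;
  ract : G -> {additive opmod_sort -> opmod_sort} }.

Definition is_right_module (K : set G) (M : opmod) : Prop :=
  (forall m, ract M 1%g m = m) /\
  (forall g h, K g -> K h -> forall m, ract M h (ract M g m) = ract M (g * h)%g m).

Definition equivariant (K : set G) (M N : opmod) (f : M -> N) : Prop :=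
  forall g, K g -> forall m, f (ract M g m) = ract N g (f m).

Definition projective (K : set G) (P : opmod) : Prop :=
  forall (M N : opmod) (p : {additive M -> N}) (f : {additive P -> N}),
  is_right_module K M -> is_right_module K N ->
  equivariant K p -> equivariant K f -> (forall n, exists m, p m = n) ->
  exists2 f' : {additive P -> M}, equivariant K f' & forall x, p (f' x) = f x.

Definition coinv_rel (K : set G) (M N : opmod) : set (tensor M N) :=
  [set v | exists k t, K k /\ v = tens_map (ract M k) (ract N k) t - t].

(* [M \otimes_K N] *)
Definition tensor_over (K : set G) (M N : opmod) := quotg (@coinv_rel K M N).
HB.instance Definition _ K M N := GRing.Zmodule.on (tensor_over K M N).

Definition tens_over (K : set G) (M N : opmod) (m : M) (n : N) :
  tensor_over K M N := cls (@coinv_rel K M N) (tens m n).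

Definition tens_over_map (K K' : set G) (M N M' N' : opmod)
    (f : {additive M -> M'}) (g : {additive N -> N'}) :
    {additive tensor_over K M N -> tensor_over K' M' N'} :=
  qmap (@coinv_rel K M N) (@coinv_rel K' M' N') (tens_map f g).

(* As for modules, [smap W g] is only relevant for [g] in [S]. *)
Record sheaf (X : gset) := Sheaf {
  stalk : X -> zmodType;
  smap : forall (g : G) (x : X), {additive stalk x -> stalk (gact x g)} }.

(* The equations are between elements of stalks at points which are provably
   but not definitionally equal, whence the dependent pairs. *)
Definition is_sheaf (S : set G) (X : gset) (W : sheaf X) : Prop :=
  (forall x (w : stalk W x),
     existT (stalk W) _ (smap W 1%g x w) = existT (stalk W) x w) /\
  (forall g h, S g -> S h -> forall x (w : stalk W x),
     existT (stalk W) _ (smap W h _ (smap W g x w)) =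
     existT (stalk W) _ (smap W (g * h)%g x w)).

Section SheafModules.
Variables (X : gset) (W : sheaf X).

Definition sheaf_sum_act (g : G) : dsum (stalk W) -> dsum (stalk W) :=
  dsum_lift (fun x => dsum_in \o smap W g x).

HB.instance Definition _ g := GRing.Additive.on (sheaf_sum_act g).

Definition sheaf_sum : opmod := OpMod sheaf_sum_act.

(* [smap W g] seen as a homomorphism from the stalk at [x] to the stalk at [y],
   when [gact x g = y]. *)
Definition smap_to (g : G) (x y : X) (w : stalk W x) : stalk W y :=
  if pselect (gact x g = y) is left e then ecast z (stalk W z) e (smap W g x w)
  else 0.

Fact smap_to_is_zmod_morphism g x y : zmod_morphism (@smap_to g x y).
Proof.
move=> v w; rewrite /smap_to; case: pselect => [e|_]; last by rewrite subr0.
by case: _ / e; rewrite raddfB.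
Qed.

HB.instance Definition _ g x y := GRing.isZmodMorphism.Build _ _ (@smap_to g x y)
  (@smap_to_is_zmod_morphism g x y).

Definition stalk_mod (x : X) : opmod := @OpMod (stalk W x) (fun g => @smap_to g x x).

Lemma sheaf_sumE g x (w : stalk W x) :
  ract sheaf_sum g (dsum_in w) = dsum_in (smap W g x w).
Proof. by rewrite /= /sheaf_sum_act dsum_lift_in. Qed.

Lemma smap_toE g x y (w : stalk W x) : gact x g = y ->
  existT (stalk W) _ (smap W g x w) = existT (stalk W) y (smap_to g y w).
Proof. by move=> e; rewrite /smap_to; case: pselect => // e'; case: _ / e'. Qed.

End SheafModules.


Lemma sheaf_sum_module (S : set G) (X : gset) (W : sheaf X) :
  is_sheaf S W -> is_right_module S (sheaf_sum W).
Proof.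
move=> [W1 Wm].
have in_eq x y (v : stalk W x) (w : stalk W y) :
    existT (stalk W) x v = existT (stalk W) y w -> dsum_in v = dsum_in w.
  by move=> e; have := congr1 (fun p : {z & stalk W z} => dsum_in (projT2 p)) e.
split=> [m|g h Sg Sh m].
  apply: (@dsum_ext _ _ _ (ract (sheaf_sum W) 1%g) idfun) => x w.
  by rewrite sheaf_sumE; exact: in_eq.
apply: (@dsum_ext _ _ _ (ract (sheaf_sum W) h \o ract (sheaf_sum W) g)
  (ract (sheaf_sum W) (g * h)%g)) => x w.
transitivity (ract (sheaf_sum W) h (ract (sheaf_sum W) g (dsum_in w))) => //.
by rewrite !sheaf_sumE; exact/in_eq/Wm.
Qed.

Lemma smap_to_comp (S : set G) (X : gset) (W : sheaf X) : is_sheaf S W ->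
  forall g h x y z (w : stalk W x), S g -> S h -> gact x g = y -> gact y h = z ->
  smap_to h z (smap_to g y w) = smap_to (g * h)%g z w.
Proof.
move=> [_ Wm] g h x y z w Sg Sh; case: _ / => e.
have eg : gact x (g * h)%g = z by rewrite -gactM.
have E : existT (stalk W) z (smap_to h z (smap_to g (gact x g) w)) =
         existT (stalk W) z (smap_to (g * h)%g z w).
  rewrite -(smap_toE _ eg) -(smap_toE _ e) -Wm //.
  congr existT; congr (smap W h _ _); rewrite /smap_to; case: pselect => // e'.
  by rewrite (Prop_irrelevance e' erefl).
exact: (existT_inj2 E).
Qed.

Section HeckeOperators.
Variables Gam S : set G.

(* The set of indices is finite in all uses below, by [coset_support_fin];
   [fset_set] of an infinite set is empty. *)
Definition hecke_sum (V V' : zmodType) (R : set G) (h : G -> int)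
    (u : G -> {additive V -> V'}) (v : V) : V' :=
  \sum_(g <- fset_set (R `&` [set g | h g != 0])) u g v *~ h g.

Fact hecke_sum_is_zmod_morphism V V' R h u :
  zmod_morphism (@hecke_sum V V' R h u).
Proof.
move=> v w; rewrite /hecke_sum -sumrB; apply: eq_bigr => g _.
by rewrite raddfB mulrzBl.
Qed.

HB.instance Definition _ V V' R h u := GRing.isZmodMorphism.Build _ _
  (@hecke_sum V V' R h u) (@hecke_sum_is_zmod_morphism V V' R h u).

(* The operator T_h on M \otimes_Gam F; it is well defined, and does not depend
   on the choice of representatives, by [hecke_opE]. *)
Definition hecke_op (M F : opmod) (h : G -> int) :
    tensor_over Gam M F -> tensor_over Gam M F :=
  qmap (@coinv_rel Gam M F) (@coinv_rel Gam M F)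
    (hecke_sum (coset_reps Gam S) h (fun g => tens_map (ract M g) (ract F g))).

HB.instance Definition _ M F h := GRing.Additive.on (@hecke_op M F h).

Variables (X : gset) (W : sheaf X) (F : opmod).

(* h_ab *)
Definition hecke_entry (h : G -> int) (a b : X) (g : G) : int :=
  if gact a g == b then h g else 0.

(* T_ab; see [hecke_entry_opE]. *)
Definition hecke_entry_op (h : G -> int) (a b : X) :
    tensor_over (stab Gam a) (stalk_mod W a) F ->
    tensor_over (stab Gam b) (stalk_mod W b) F :=
  qmap (@coinv_rel (stab Gam a) (stalk_mod W a) F)
    (@coinv_rel (stab Gam b) (stalk_mod W b) F)
    (hecke_sum (coset_reps (stab Gam b) S) (hecke_entry h a b)
       (fun t => tens_map (@smap_to X W t a b) (ract F t))).

HB.instance Definition _ h a b := GRing.Additive.on (@hecke_entry_op h a b).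

Variable A : set X.

(* \bigoplus_(a in A) W_a \otimes_(Gam_a) F *)
Definition orbit_sum :=
  dsum (fun a : A => tensor_over (stab Gam (sval a)) (stalk_mod W (sval a)) F).
HB.instance Definition _ := GRing.Zmodule.on orbit_sum.

(* The formula characterizing lambda; the classes on which it prescribes its
   values generate the domain. *)
Definition is_lambda
    (lam : {additive tensor_over Gam (sheaf_sum W) F -> orbit_sum}) : Prop :=
  forall (a : A) k (w : stalk W (gact (sval a) k)) (f : F), Gam k ->
  lam (tens_over Gam (dsum_in w : sheaf_sum W) f) =
  dsum_in (tens_over (stab Gam (sval a))
    (smap_to k^-1%g (sval a) w : stalk_mod W (sval a)) (ract F k^-1%g f)).

End HeckeOperators.

#[global] Arguments hecke_op Gam S {M F} h c.
#[global] Arguments hecke_entry_op Gam S {X W F} h a b c.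
#[global] Arguments orbit_sum Gam {X} W F A.
#[global] Arguments is_lambda Gam {X} W F A lam.

Section CosetSums.
Implicit Types K L S R : set G.

Lemma left_cosetP L g x : subgroup L -> left_coset g L x ->
  left_coset x L = left_coset g L.
Proof.
move=> [L1 LM LV] [k Lk <-]; apply/seteqP; split=> _ [l Ll <-].
  by exists (k * l)%g; [exact: LM|rewrite mulgA].
exists (k^-1 * l)%g; first by apply: LM => //; exact: LV.
by rewrite mulgA mulgK.
Qed.

Lemma left_coset_refl L g : subgroup L -> left_coset g L g.
Proof. by case=> L1 _ _; exists 1%g => //; rewrite mulg1. Qed.

Lemma coset_repP L g : subgroup L -> left_coset g L (coset_rep L g).
Proof. by move=> sL; apply: xgetPex; exists g; exact: left_coset_refl. Qed.

Lemma coset_rep_eq L g x : subgroup L -> left_coset g L x ->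
  coset_rep L x = coset_rep L g.
Proof. by move=> sL gx; rewrite /coset_rep (left_cosetP sL gx). Qed.

Lemma coset_repsP L S : subgroup L -> (forall g l, S g -> L l -> S (g * l)%g) ->
  is_coset_reps L S (coset_reps L S).
Proof.
move=> sL SL; split=> [_ [g Sg <-]|g Sg].
  by have [l Ll <-] := coset_repP g sL; exact: SL.
exists (coset_rep L g); split.
  split; first by exists g.
  by rewrite (left_cosetP sL (coset_repP g sL)); exact: left_coset_refl.
move=> _ [[x Sx <-] xg]; apply/esym.
rewrite (coset_rep_eq sL xg).
by rewrite (coset_rep_eq sL (coset_repP x sL)).
Qed.

Lemma coset_reps_inj L S R x y : subgroup L -> is_coset_reps L S R ->
  R x -> R y -> left_coset x L = left_coset y L -> x = y.
Proof.
move=> sL [RS Rex] Rx Ry xy; have [r [_ ru]] := Rex x (RS _ Rx).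
rewrite -(ru x) ?(ru y) //; split=> //; last exact: left_coset_refl.
by rewrite -xy; exact: left_coset_refl.
Qed.

Variables (V V' : zmodType) (P : set V) (P' : set V').
Variables (K L S : set G) (h : G -> int) (u : G -> {additive V -> V'}).
Variables (aK : G -> V -> V) (aL : G -> V' -> V').

Hypothesis sK : subgroup K.
Hypothesis sL : subgroup L.
Hypothesis KS : forall k g, K k -> S g -> S (k * g)%g.
Hypothesis SL : forall g l, S g -> L l -> S (g * l)%g.
Hypothesis hK : forall k g, K k -> S g -> h (k * g)%g = h g.
Hypothesis hL : forall g l, S g -> L l -> h (g * l)%g = h g.
Hypothesis hfin : finite_set [set left_coset g L | g in [set g | S g /\ h g != 0]].
Hypothesis Prel : forall v, P v -> exists k x, K k /\ v = aK k x - x.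
Hypothesis Prel' : forall l x, L l -> cls P' (aL l x) = cls P' x.
Hypothesis uK : forall k g v, K k -> S g -> h g != 0 -> u (k * g)%g v = u g (aK k v).
Hypothesis uL : forall g l v, S g -> L l -> h g != 0 -> u (g * l)%g v = aL l (u g v).

Lemma coset_support_fin R : is_coset_reps L S R ->
  finite_set (R `&` [set g | h g != 0]).
Proof.
move=> Rr; have [RS _] := Rr.
rewrite -(@eq_finite_set _ _ [set left_coset g L | g in R `&` [set g | h g != 0]]).
  by apply: sub_finite_set hfin => _ [g [/RS Sg hg] <-]; exists g.
apply: inj_card_eq => x y; rewrite !inE => -[Rx _] [Ry _] xy.
exact: coset_reps_inj sL Rr Rx Ry xy.
Qed.

Lemma hecke_sum_cls R v : is_coset_reps L S R ->
  cls P' (hecke_sum R h u v) =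
  \sum_(g \in coset_reps L S `&` [set g | h g != 0]) cls P' (u g v *~ h g).
Proof.
move=> Rr; have Rfin := coset_support_fin Rr; have [RS Rex] := Rr.
have -> : coset_reps L S `&` [set g | h g != 0] =
          coset_rep L @` (R `&` [set g | h g != 0]).
  apply/seteqP; split=> [x [[g Sg <-] /= hx]|_ [g [Rg /= hg] <-]].
    have [r [[Rr' rg] _]] := Rex g Sg.
    have gr := coset_rep_eq sL rg.
    exists r => //; split=> //=; move: hx; rewrite gr.
    by have [l Ll <-] := coset_repP r sL; rewrite hL //; exact: RS.
  split; first by exists g => //; exact: RS.
  by have [l Ll <-] := coset_repP g sL; rewrite /= hL //; exact: RS.
rewrite fsbig_image; last first.
  move=> x y; rewrite !inE => -[Rx _] [Ry _] xy.
  apply: (coset_reps_inj sL Rr Rx Ry).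
  by rewrite -(left_cosetP sL (coset_repP x sL)) xy (left_cosetP sL (coset_repP y sL)).
rewrite fsbig_finite // /hecke_sum raddf_sum; apply: eq_big_seq => g.
rewrite in_fset_set // inE => -[Rg /= hg]; have Sg := RS _ Rg.
have [l Ll <-] := coset_repP g sL.
by rewrite hL // uL // !raddfMz /= Prel'.
Qed.

Lemma hecke_sum_descends R : is_coset_reps L S R ->
  descends P P' (hecke_sum R h u).
Proof.
move=> Rr _ /Prel[k [x [Kk ->]]]; have [RS Rex] := Rr; have [K1 KM KV] := sK.
have Rfin := coset_support_fin Rr.
have kR : is_coset_reps L S [set (k * r)%g | r in R].
  split=> [_ [r Rr' <-]|g Sg]; first by apply: KS => //; exact: RS.
  have [r [[Rr' [l Ll rl]] ru]] := Rex (k^-1 * g)%g (KS (KV _ Kk) Sg).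
  exists (k * r)%g; split.
    split; first by exists r.
    by exists l => //; rewrite -mulgA rl mulVKg.
  move=> _ [[r' Rr'' <-] [l' Ll' e]]; congr (_ * _)%g; apply: ru; split=> //.
  by exists l' => //; rewrite -e -mulgA mulKg.
apply/eqP; rewrite !raddfB subr_eq0 /= [X in _ == X](hecke_sum_cls _ Rr); apply/eqP.
rewrite -(hecke_sum_cls _ kR) /hecke_sum.
congr cls; transitivity (\sum_(g \in [set (k * r)%g | r in R] `&` [set g | h g != 0])
   u g x *~ h g); last by rewrite fsbig_finite //; exact: coset_support_fin.
have -> : [set (k * r)%g | r in R] `&` [set g | h g != 0] =
   [set (k * r)%g | r in R `&` [set g | h g != 0]].
  apply/seteqP; split=> [_ [[r Rr' <-] /= hr]|_ [r [Rr' /= hr] <-]].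
    by exists r => //; split=> //=; rewrite -(hK Kk) //; exact: RS.
  by split; [exists r|rewrite /= hK //; exact: RS].
rewrite fsbig_image; last by move=> ? ? _ _ /mulgI.
rewrite fsbig_finite //; apply: eq_big_seq => g.
rewrite in_fset_set // inE => -[Rg /= hg]; have Sg := RS _ Rg.
by rewrite uK // hK.
Qed.

Lemma hecke_qmapE R v : is_coset_reps L S R ->
  qmap P P' (hecke_sum (coset_reps L S) h u) (cls P v) = cls P' (hecke_sum R h u v).
Proof.
move=> Rr; have cr := coset_repsP sL SL.
by rewrite qmapE; [rewrite !hecke_sum_cls|exact: hecke_sum_descends].
Qed.

End CosetSums.

Lemma hecke_support_fin (Gam S : set G) h : hecke_pair Gam S ->
  hecke_fun Gam S h ->
  finite_set [set left_coset g Gam | g in [set g | S g /\ h g != 0]].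
Proof.
move=> [sG SS GS fin] [_ _ _ hfin]; have [G1 GM GV] := sG.
set D := (X in finite_set X) in hfin.
apply: sub_finite_set (_ : finite_set (\bigcup_(d in D) [set left_coset x Gam | x in d])).
  move=> _ [g Sg <-]; exists (double_coset Gam g); first by exists g.
  by exists g => //; exists 1%g => //; exists 1%g => //; rewrite mul1g mulg1.
apply: bigcup_finite => // _ [g [Sg hg] <-].
have [_ gfin] := fin g Sg.
pose Phi (C : set G) := [set (c * g * l)%g | c in C & l in Gam].
apply: sub_finite_set (finite_image Phi gfin).
move=> _ [_ [k Gk [l Gl <-]] <-]; eexists; first by exists k.
rewrite /Phi; apply/seteqP; split.
  move=> _ [_ [_ [[m Gm <-] Gc] <-]] [n Gn <-].
  exists (l^-1 * (m * n))%g; first by apply: (GM); [exact: GV|exact: GM].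
  by rewrite !mulgA !mulgK mulgVK.
move=> _ [n Gn <-]; exists k.
  exists 1%g; last by rewrite mulg1.
  by split=> //; exists 1%g => //; rewrite mulg1 mulgV.
by exists (l * n)%g; [exact: GM|rewrite !mulgA].
Qed.

Lemma coinv_rel_cls (K : set G) (M F : opmod) k x : K k ->
  cls (@coinv_rel K M F) (tens_map (ract M k) (ract F k) x) = cls (@coinv_rel K M F) x.
Proof.
by move=> Kk; apply/eqP; rewrite -subr_eq0 -raddfB; apply/eqP/cls_rel; exists k, x.
Qed.

Section WellDefined.
Variables (Gam S : set G) (h : G -> int) (F : opmod).
Hypothesis GS : hecke_pair Gam S.
Hypothesis hH : hecke_fun Gam S h.
Hypothesis FS : is_right_module S F.

Lemma hecke_opE (M : opmod) (R : set G) z : is_right_module S M ->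
  is_coset_reps Gam S R ->
  hecke_op Gam S h (cls (@coinv_rel Gam M F) z) =
  cls (@coinv_rel Gam M F)
    (\sum_(g <- fset_set (R `&` [set g | h g != 0]))
       tens_map (ract M g) (ract F g) z *~ h g).
Proof.
move=> [M1 MM] Rr; have [F1 FM] := FS; have [sG SS GSs _] := GS.
have hfin := hecke_support_fin GS hH; have [h0 hl hr _] := hH.
have comp g k v : S g -> S k ->
    tens_map (ract M (g * k)%g) (ract F (g * k)%g) v =
    tens_map (ract M k) (ract F k) (tens_map (ract M g) (ract F g) v).
  move=> Sg Sk; apply: (@tensor_ext _ _ _ (tens_map (ract M (g * k)%g) (ract F (g * k)%g))
    (tens_map (ract M k) (ract F k) \o tens_map (ract M g) (ract F g))) => m n.
  transitivity (tens_map (ract M k) (ract F k) (tens_map (ract M g) (ract F g) (tens m n))) => //.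
  by rewrite /= !tens_mapE MM // FM //.
pose a g := tens_map (ract M g) (ract F g).
apply: (@hecke_qmapE _ _ _ _ Gam Gam S h _ a a) => //.
- by move=> k g Gk Sg; apply: SS => //; exact: GSs.
- by move=> g k Sg Gk; apply: SS => //; exact: GSs.
- by move=> g l Sg Gl; exact: hr.
- by move=> l x Gl; exact: coinv_rel_cls.
- by move=> k g v Gk Sg _; exact: comp (GSs _ Gk) Sg.
- by move=> g k v Sg Gk _; exact: comp Sg (GSs _ Gk).
Qed.

Lemma stab_subgroup (X : gset) (x : X) : subgroup (stab Gam x).
Proof.
have [[G1 GM GV] _ _ _] := GS; split.
- by split=> //; exact: gact1.
- by move=> g k [Gg xg] [Gk xk]; split; [exact: GM|rewrite -gactM xg].
- by move=> g [Gg xg]; split; [exact: GV|rewrite -{1}xg gactM mulgV gact1].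
Qed.

Lemma hecke_entryP (X : gset) (a b : X) g : hecke_entry h a b g != 0 ->
  gact a g = b /\ h g != 0.
Proof. by rewrite /hecke_entry; case: ifP => [/eqP ag hg|_]; [split|]. Qed.

Lemma hecke_entry_support_fin (X : gset) (a b : X) :
  finite_set [set left_coset g (stab Gam b) |
              g in [set g | S g /\ hecke_entry h a b g != 0]].
Proof.
have hfin := hecke_support_fin GS hH.
apply: sub_finite_set (finite_image (fun C => C `&` [set x | gact a x = b]) hfin).
move=> _ [g [Sg /hecke_entryP[ag hg]] <-]; exists (left_coset g Gam); first by exists g.
apply/seteqP; split=> [_ [[k Gk <-] /= e]|_ [k [Gk bk] <-]].
  by exists k => //; split=> //; rewrite -{1}ag gactM.
by split; [exists k|rewrite /= -gactM ag].
Qed.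

Lemma hecke_entry_opE (X : gset) (W : sheaf X) (a b : X) (R : set G) z :
  is_sheaf S W -> is_coset_reps (stab Gam b) S R ->
  hecke_entry_op Gam S h a b
    (cls (@coinv_rel (stab Gam a) (stalk_mod W a) F) z) =
  cls (@coinv_rel (stab Gam b) (stalk_mod W b) F)
    (\sum_(t <- fset_set (R `&` [set t | hecke_entry h a b t != 0]))
       tens_map (smap_to t b) (ract F t) z *~ hecke_entry h a b t).
Proof.
move=> SW Rr; have [F1 FM] := FS; have [sG SS GSs _] := GS.
have hfin := hecke_support_fin GS hH; have [h0 hl hr _] := hH.
have hab g := @hecke_entryP X a b g.
have comp g k y v : S g -> S k -> gact a g = y -> gact y k = b ->
    tens_map (@smap_to X W (g * k)%g a b) (ract F (g * k)%g) v =
    tens_map (@smap_to X W k y b) (ract F k)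
      (tens_map (@smap_to X W g a y) (ract F g) v).
  move=> Sg Sk ay yb; apply: (@tensor_ext _ _ _
    (tens_map (@smap_to X W (g * k)%g a b) (ract F (g * k)%g))
    (tens_map (@smap_to X W k y b) (ract F k) \o
      tens_map (@smap_to X W g a y) (ract F g))) => m n.
  transitivity (tens_map (@smap_to X W k y b) (ract F k)
      (tens_map (@smap_to X W g a y) (ract F g) (tens m n))) => //.
  by rewrite /= !tens_mapE /= (smap_to_comp SW) // FM //.
apply: (@hecke_qmapE _ _ _ _ (stab Gam a) (stab Gam b) S (hecke_entry h a b) _
  (fun g => tens_map (@smap_to X W g a a) (ract F g))
  (fun g => tens_map (@smap_to X W g b b) (ract F g))) => //.
- exact: stab_subgroup.
- exact: stab_subgroup.
- by move=> k g [Gk _] Sg; apply: SS => //; exact: GSs.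
- by move=> g k Sg [Gk _]; apply: SS => //; exact: GSs.
- by move=> k g [Gk ak] Sg; rewrite /hecke_entry -gactM ak hl.
- move=> g l Sg [Gl bl]; rewrite /hecke_entry -gactM hr //.
  case: (eqVneq (gact a g) b) => [->|nab]; first by rewrite bl eqxx.
  case: eqP => // e; case/eqP: nab.
  by rewrite -(gact1 (gact a g)) -(mulgV l) -gactM e -{1}bl gactM mulgV gact1.
- exact: hecke_entry_support_fin.
- by move=> l x Gl; exact: (@coinv_rel_cls _ (stalk_mod W b)).
- move=> k g v [Gk ak] Sg /hab[ag _].
  exact: comp (GSs _ Gk) Sg ak ag.
- move=> g k v Sg [Gk bk] /hab[ag _].
  exact: comp Sg (GSs _ Gk) ag bk.
Qed.

End WellDefined.

End Groups.

Section Complexes.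

Record zcomplex := ZComplex {
  zc :> nat -> zmodType;
  zd : forall n, {additive zc n.+1 -> zc n} }.

Definition cycles (C : zcomplex) (q : nat) : {pred C q} :=
  match q return {pred C q} with
  | 0 => predT
  | n.+1 => fun z : C n.+1 => zd C n z == 0
  end.
Arguments cycles : clear implicits.

Fact cycles_zmod C q : zmod_closed (cycles C q).
Proof.
case: q => [|n]; split=> //; first by rewrite unfold_in /= raddf0.
by move=> x y; rewrite !unfold_in /= => /eqP hx /eqP hy; rewrite raddfB hx hy subr0.
Qed.

HB.instance Definition _ (C : zcomplex) q := GRing.isZmodClosed.Build (C q) (cycles C q)
  (cycles_zmod C q).

Definition cycle (C : zcomplex) (q : nat) := {z : C q | z \in cycles C q}.
HB.instance Definition _ (C : zcomplex) q := SubChoice.on (cycle C q).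
HB.instance Definition _ (C : zcomplex) q := [SubChoice_isSubZmodule of cycle C q by <:].

Definition boundaries (C : zcomplex) (q : nat) : set (cycle C q) :=
  [set z | exists y : C q.+1, val z = zd C q y].

Definition homology (C : zcomplex) (q : nat) := quotg (@boundaries C q).
HB.instance Definition _ (C : zcomplex) q := GRing.Zmodule.on (homology C q).

Definition hcls (C : zcomplex) (q : nat) (z : cycle C q) : homology C q :=
  cls (@boundaries C q) z.

(* The map induced on homology by the component [f] of a chain map (see
   [hmapE]). *)
Definition hmap (C D : zcomplex) (q : nat) (f : C q -> D q)
    (c : homology C q) : homology D q :=
  hcls (insubd 0 (f (val (repr c : cycle C q)))).

Lemma hmapE (C D : zcomplex) (f : forall n, {additive C n -> D n}) q
    (z : cycle C q) (z' : cycle D q) :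
  (forall n x, f n (zd C n x) = zd D n (f n.+1 x)) ->
  val z' = f q (val z) -> hmap (f q) (hcls z) = hcls z'.
Proof.
move=> fd z'E; rewrite /hmap; set r : cycle C q := repr _.
have fr : f q (val r) \in cycles D q.
  move: (valP r); move: (val r); case: q {z z' z'E r} => // n x.
  by rewrite !unfold_in /= => /eqP dx; rewrite -fd dx raddf0.
have [y yE] : exists y, val (r - z) = zd C q y.
  have : cls (@boundaries C q) (r - z) = 0.
    by rewrite raddfB /= {1}/cls reprK subrr.
  move/cls_eq0 => /(_ [set v | exists y, val v = zd C q y]); apply => //=.
    by exists 0; rewrite !raddf0.
  by move=> v w [y yE] [y' yE']; exists (y - y'); rewrite !raddfB /= yE yE'.
apply/eqP; rewrite -subr_eq0 /hcls -raddfB; apply/eqP/cls_rel.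
by exists (f q.+1 y); rewrite -fd -yE !raddfB /= insubdK // z'E.
Qed.

End Complexes.

Section Homology.
Variable G : groupType.

Record opcomplex := OpComplex {
  ocx :> nat -> opmod G;
  ocd : forall n, {additive ocx n.+1 -> ocx n};
  oaug : {additive ocx 0 -> int} }.

(* [int] carries the trivial operation. *)
Definition equivariant_complex (K : set G) (F : opcomplex) : Prop :=
  [/\ forall n, is_right_module K (F n),
      forall n, equivariant K (ocd F n) &
      forall g, K g -> forall x, oaug F (ract (F 0) g x) = oaug F x].

Definition is_resolution (F : opcomplex) : Prop :=
  [/\ forall m, exists x, oaug F x = m,
      forall x : F 0, oaug F x = 0 <-> exists y, x = ocd F 0 y &
      forall n (x : F n.+1), ocd F n x = 0 <-> exists y, x = ocd F n.+1 y].

Definition projective_resolution (K : set G) (F : opcomplex) : Prop :=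
  [/\ equivariant_complex K F, is_resolution F & forall n, projective K (F n)].

Definition tensor_complex (K : set G) (M : opmod G) (F : opcomplex) : zcomplex :=
  ZComplex (fun n => tens_over_map K K (idfun : {additive M -> M}) (ocd F n)).

(* H_q(K, M), for a projective resolution [F] of Z over Z[K]. *)
Definition ghomology (K : set G) (M : opmod G) (F : opcomplex) (q : nat) :=
  homology (tensor_complex K M F) q.
HB.instance Definition _ K M F q := GRing.Zmodule.on (ghomology K M F q).

End Homology.

Section ChainMaps.
Variables (G : groupType) (Gam S : set G) (h : G -> int) (F : opcomplex G).
Hypothesis GS : hecke_pair Gam S.
Hypothesis hH : hecke_fun Gam S h.
Hypothesis FS : equivariant_complex S F.

Lemma tens_over_mapE (K : set G) (M : opmod G) n (x : tensor M (F n.+1)) :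
  K `<=` S ->
  tens_over_map K K (idfun : {additive M -> M}) (ocd F n)
    (cls (@coinv_rel G K M (F n.+1)) x) =
  cls (@coinv_rel G K M (F n)) (tens_map idfun (ocd F n) x).
Proof.
move=> KS; have [_ dS _] := FS; apply: qmapE => _ [k [t [Kk ->]]].
rewrite raddfB; apply: cls_rel; exists k, (tens_map idfun (ocd F n) t); split=> //.
congr (_ - _).
apply: (@tensor_ext _ _ _
  (tens_map idfun (ocd F n) \o tens_map (ract M k) (ract (F n.+1) k))
  (tens_map (ract M k) (ract (F n) k) \o tens_map idfun (ocd F n))) => m f.
transitivity (tens_map (idfun : {additive M -> M}) (ocd F n)
  (tens_map (ract M k) (ract (F n.+1) k) (tens m f))) => //.
rewrite !tens_mapE /=. rewrite !tens_mapE dS //; exact: KS.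
Qed.

(* The operators [hecke_op] and [hecke_entry_op] are chain maps. *)
Lemma hecke_op_d (M : opmod G) n (c : tensor_over Gam M (F n.+1)) :
  is_right_module S M ->
  hecke_op Gam S h (zd (tensor_complex Gam M F) n c) =
  zd (tensor_complex Gam M F) n (hecke_op Gam S h c).
Proof.
move=> MS; have [FM dS _] := FS; have [sG SS GSs _] := GS.
have [v ->] := cls_surj c.
have SG g l : S g -> Gam l -> S (g * l)%g by move=> ? /GSs; exact: SS.
have cr := coset_repsP sG SG; have [RS _] := cr.
have fin := coset_support_fin sG (hecke_support_fin GS hH) cr.
rewrite [zd]/zd /= tens_over_mapE // !(hecke_opE GS hH (FM _) _ MS cr) tens_over_mapE //.
congr cls; rewrite raddf_sum; apply: eq_big_seq => g.
rewrite in_fset_set // inE => -[/RS Sg _]; rewrite raddfMz; congr (_ *~ _).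
apply: (@tensor_ext _ _ _
  (tens_map (ract M g) (ract (F n) g) \o tens_map (idfun : {additive M -> M}) (ocd F n))
  (tens_map (idfun : {additive M -> M}) (ocd F n) \o
   tens_map (ract M g) (ract (F n.+1) g))) => m f.
transitivity (tens_map (ract M g) (ract (F n) g)
  (tens_map (idfun : {additive M -> M}) (ocd F n) (tens m f))) => //.
by rewrite !tens_mapE /= !tens_mapE /= dS.
Qed.

Lemma hecke_entry_op_d (X : gset G) (W : sheaf X) (a b : X) n
    (c : tensor_over (stab Gam a) (stalk_mod W a) (F n.+1)) : is_sheaf S W ->
  hecke_entry_op Gam S h a b
    (zd (tensor_complex (stab Gam a) (stalk_mod W a) F) n c) =
  zd (tensor_complex (stab Gam b) (stalk_mod W b) F) n
    (hecke_entry_op Gam S h a b c).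
Proof.
move=> WS; have [FM dS _] := FS; have [sG SS GSs _] := GS.
have [v ->] := cls_surj c.
have stS x : stab Gam x `<=` S by move=> g [/GSs].
have SG g l : S g -> stab Gam b l -> S (g * l)%g by move=> ? /stS; exact: SS.
have cr := coset_repsP (stab_subgroup GS b) SG; have [RS _] := cr.
have fin := coset_support_fin (stab_subgroup GS b) (hecke_entry_support_fin GS hH a b) cr.
rewrite [zd]/zd /= (@tens_over_mapE _ (stalk_mod W a)) //.
rewrite !(hecke_entry_opE GS hH (FM _) _ WS cr).
rewrite (@tens_over_mapE _ (stalk_mod W b)) //.
congr cls; rewrite raddf_sum; apply: eq_big_seq => g.
rewrite in_fset_set // inE => -[/RS Sg _]; rewrite raddfMz; congr (_ *~ _).
apply: (@tensor_ext _ _ _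
  (tens_map (@smap_to G X W g a b) (ract (F n) g) \o
   tens_map (idfun : {additive stalk_mod W a -> stalk_mod W a}) (ocd F n))
  (tens_map (idfun : {additive stalk_mod W b -> stalk_mod W b}) (ocd F n) \o
   tens_map (@smap_to G X W g a b) (ract (F n.+1) g))) => m f.
transitivity (tens_map (@smap_to G X W g a b) (ract (F n) g)
  (tens_map (idfun : {additive stalk_mod W a -> stalk_mod W a}) (ocd F n) (tens m f))) => //.
by rewrite !tens_mapE /= !tens_mapE /= dS.
Qed.

End ChainMaps.

Section OrbitHomology.
Variables (G : groupType) (Gam S : set G) (X : gset G) (W : sheaf X).
Variables (F : opcomplex G) (q : nat).

Definition hecke_homology (M : opmod G) (h : G -> int) :
    ghomology Gam M F q -> ghomology Gam M F q :=
  hmap (C := tensor_complex Gam M F) (D := tensor_complex Gam M F)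
    (hecke_op Gam S h).

Definition hecke_entry_homology (h : G -> int) (a b : X) :
    ghomology (stab Gam a) (stalk_mod W a) F q ->
    ghomology (stab Gam b) (stalk_mod W b) F q :=
  hmap (C := tensor_complex (stab Gam a) (stalk_mod W a) F)
    (D := tensor_complex (stab Gam b) (stalk_mod W b) F)
    (hecke_entry_op Gam S h a b).

(* The map H_q(Gam_a, W_a) -> H_q(Gam, W) induced by the inclusions of Gam_a in
   Gam and of W_a in W. *)
Definition shapiro_in (a : X) :
    ghomology (stab Gam a) (stalk_mod W a) F q ->
    ghomology Gam (sheaf_sum W) F q :=
  hmap (C := tensor_complex (stab Gam a) (stalk_mod W a) F)
    (D := tensor_complex Gam (sheaf_sum W) F)
    (tens_over_map (stab Gam a) Gam
      (dsum_in : {additive stalk_mod W a -> sheaf_sum W})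
      (idfun : {additive F q -> F q})).

Variable A : set X.

(* \bigoplus_(a in A) H_q(Gam_a, W_a) *)
Definition orbit_homology :=
  dsum (fun a : A => ghomology (stab Gam (sval a)) (stalk_mod W (sval a)) F q).
HB.instance Definition _ := GRing.Zmodule.on orbit_homology.

(* The isomorphism of Shapiro's lemma is the inverse of the map with components
   [shapiro_in a]. *)
Definition shapiro_iso
    (Lam : ghomology Gam (sheaf_sum W) F q -> orbit_homology) : Prop :=
  bijective Lam /\
  forall (a : A) (c : ghomology (stab Gam (sval a)) (stalk_mod W (sval a)) F q),
    Lam (shapiro_in c) =
    dsum_in (V := fun a : A => ghomology (stab Gam (sval a)) (stalk_mod W (sval a)) F q) c.

(* [Lam] is the map induced on homology by [lam], taken in degree q, via
   the identification of the homology of a direct sum of complexes with the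
   direct sum of their homologies. *)
Definition induced_on_homology
    (lam : tensor_over Gam (sheaf_sum W) (F q) -> orbit_sum Gam W (F q) A)
    (Lam : ghomology Gam (sheaf_sum W) F q -> orbit_homology) : Prop :=
  forall (z : cycle (tensor_complex Gam (sheaf_sum W) F) q) (a : A),
  exists2 za : cycle (tensor_complex (stab Gam (sval a)) (stalk_mod W (sval a)) F) q,
    val za = lam (val z) a & Lam (hcls z) a = hcls za.

End OrbitHomology.

#[global] Arguments hecke_homology {G} Gam S {F q M} h c.
#[global] Arguments hecke_entry_homology {G} Gam S {X W F q} h a b c.
#[global] Arguments shapiro_in {G} Gam {X W F q} a c.
#[global] Arguments orbit_homology {G} Gam {X} W F q A.
#[global] Arguments induced_on_homology {G Gam X W F q A} lam Lam.
#[global] Arguments shapiro_iso {G Gam X W F q A} Lam.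

(* Main.v *)
From HB Require Import structures.
Require Import Defs.
From mathcomp Require Import all_boot all_order all_algebra.
From mathcomp Require Import finmap boolp classical_sets functions cardinality fsbigop.
From mathcomp.multinomials Require Import freeg.

Set Implicit Arguments.
Unset Strict Implicit.
Unset Printing Implicit Defensive.

Import GRing.Theory.

Local Open Scope classical_set_scope.
Local Open Scope ring_scope.

(* On W \otimes_Gam F every class is a sum of classes of w \otimes f with w in W_a and
   a in A, and lambda sends such a class to w \otimes f in the component a. By
   invariance under Gam, the class of wg \otimes fg depends on the coset g Gam only; its
   b-component under lambda vanishes unless g Gam meets {t in S | at = b}, and then the
   intersection is a single coset t Gam_b and the component is wt \otimes ft. Hence
   the b-component of lambda (T_h (w \otimes f)) is the sum defining T_ab. On homology,
   the components of lambda and of its inverse are chain maps, so they induce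
   the isomorphism and its inverse, and the matrix formula passes to cycles. That F
   is projective over Gam_a follows from coinduction being exact and right
   adjoint to restriction. *)

(** * Universal properties of quotients, tensor products and direct sums *)

Lemma additive_exists (U V : zmodType) (f : U -> V) : zmod_morphism f ->
  exists g : {additive U -> V}, g =1 f.
Proof.
move=> fB; pose m := GRing.isZmodMorphism.Build U V f fB.
by exists (HB.pack f m : {additive U -> V}).
Qed.

(** The kernel of [f] is a subgroup containing [P], so the value of [f] at a chosen representative
    depends on the class only. Unlike for [qmap], the target need not be given as a quotient. *)
Lemma quot_lift (V U : zmodType) (P : set V) (f : {additive V -> U}) :
  (forall v, P v -> f v = 0) ->
  exists g : {additive quotg P -> U}, forall v, g (cls P v) = f v.
Proof.
move=> fP.
have f_repr v : f (repr (cls P v)) = f v.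
  apply/eqP; rewrite -subr_eq0 -raddfB; apply/eqP.
  have : cls P (repr (cls P v) - v) = 0 by rewrite raddfB /= {1}/cls reprK subrr.
  move/cls_eq0 => /(_ [set v | f v = 0]); apply => //=; first exact: raddf0.
  by move=> x y; rewrite raddfB => -> ->; rewrite subr0.
have [|g gE] := @additive_exists (quotg P) U (fun c => f (repr c)); last first.
  by exists g => v; rewrite gE.
move=> c d; have [v ->] := cls_surj c; have [w ->] := cls_surj d.
by rewrite -raddfB !f_repr raddfB.
Qed.

Lemma tensor_lift (M N U : zmodType) (b : M -> N -> U) :
  (forall n, zmod_morphism (b^~ n)) -> (forall m, zmod_morphism (b m)) ->
  exists g : {additive tensor M N -> U}, forall m n, g (tens m n) = b m n.
Proof.
move=> bl br.
have bDl m m' n : b (m + m') n = b m n + b m' n.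
  by have [g gE] := additive_exists (bl n); rewrite -!gE raddfD.
have bDr m n n' : b m (n + n') = b m n + b m n'.
  by have [g gE] := additive_exists (br m); rewrite -!gE raddfD.
(* [zmodule U] is [U] viewed as a module over [int], which the linear extension from the free module
   demands. *)
have [f fE] := additive_exists
  (@lift_is_additive int (M * N)%type (zmodule U) (fun p => b p.1 p.2)).
have fU p : f << p >> = b p.1 p.2.
  by rewrite fE; exact: etrans (liftU _ _ _) (scale1r _).
have [|g gE] := @quot_lift _ (zmodule U) (@tensor_rel M N) f.
  by move=> _ [[m [m' [n ->]]]|[m [n [n' ->]]]];
    rewrite !raddfB !fU /= ?bDl ?bDr addrAC addrK subrr.
by exists g => m n; rewrite gE fU.
Qed.

Lemma dsum_ind (I : choiceType) (V : I -> zmodType) (Q : dsum V -> Prop) :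
  Q 0 -> (forall x y, Q x -> Q y -> Q (x - y)) ->
  (forall i (v : V i), Q (dsum_in v)) -> forall v, Q v.
Proof.
move=> Q0 QB Qin v; rewrite -(dsum_liftK v) (dsum_liftE _ (dsum_fin v)) //.
elim/big_rec: _ => // i x _ Qx; rewrite -[x]opprK; apply: (QB); first exact: Qin.
by rewrite -sub0r; exact: QB.
Qed.

Lemma tensBl (M N : zmodType) (m m' : M) (n : N) :
  tens (m - m') n = tens m n - tens m' n.
Proof. by apply/eqP; rewrite eq_sym subr_eq -tensDl subrK. Qed.

Lemma tensBr (M N : zmodType) (m : M) (n n' : N) :
  tens m (n - n') = tens m n - tens m n'.
Proof. by apply/eqP; rewrite eq_sym subr_eq -tensDr subrK. Qed.

Lemma coset_rep_mulr (G : groupType) (L : set G) g k :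
  subgroup L -> L k -> coset_rep L (g * k)%g = coset_rep L g.
Proof. by move=> sL Lk; apply: coset_rep_eq => //; exists k. Qed.

(** * The isomorphism lambda and Hecke operators on coinvariants *)

Section Lambda.
Variables (G : groupType) (Gam S : set G) (X : gset G) (W : sheaf X) (A : set X).
Hypothesis GS : hecke_pair Gam S.
Hypothesis SW : is_sheaf S W.
Hypothesis GA : orbit_reps Gam A.

(** [smap_to] transports between stalks at equal points; the transport disappears in the direct sum,
    where [dsum_in] depends only on the dependent pair of a point and an element over it. *)
Lemma dsum_in_smap_to g (x y : X) (w : stalk W x) : gact x g = y ->
  dsum_in (smap_to g y w) = dsum_in (smap W g x w).
Proof.
move/(smap_toE w) => e.
by have := congr1 (fun p : {z & stalk W z} => dsum_in (projT2 p)) e.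
Qed.

Lemma stab_sub (x : X) : stab Gam x `<=` S.
Proof. by have [_ _ GSs _] := GS => g [/GSs]. Qed.

Section Coefficients.
Variable F : opmod G.
Hypothesis FS : is_right_module S F.

(* The class of [wk^-1 \otimes fk^-1]. *)
Definition pull (a : X) (k : G) (x : X) (w : stalk W x) (f : F) :
    tensor_over (stab Gam a) (stalk_mod W a) F :=
  tens_over (stab Gam a) (smap_to k^-1%g a w : stalk_mod W a) (ract F k^-1%g f).

Lemma pullBl a k x (w w' : stalk W x) f :
  pull a k (w - w') f = pull a k w f - pull a k w' f.
Proof.
by rewrite /pull /tens_over (raddfB (@smap_to G X W k^-1%g x a)) tensBl raddfB.
Qed.

Lemma pullBr a k x (w : stalk W x) f f' :
  pull a k w (f - f') = pull a k w f - pull a k w f'.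
Proof. by rewrite /pull /tens_over (raddfB (ract F k^-1%g)) tensBr raddfB. Qed.

(** The two choices differ by [k * k'^-1], which fixes [a] and so acts trivially on the coinvariants
    under [stab Gam a]. *)
Lemma pull_indep (a : X) k k' x (w : stalk W x) f : Gam k -> Gam k' ->
  x = gact a k -> x = gact a k' -> pull a k w f = pull a k' w f.
Proof.
have [[G1 GM GV] SS GSs _] := GS; have [F1 FM] := FS.
move=> Gk Gk' xk xk'.
have ak : gact x k^-1%g = a by rewrite xk gactM mulgV gact1.
have st : stab Gam a (k * k'^-1)%g.
  by split; [exact: GM (GV _ _)|rewrite -gactM -xk xk' gactM mulgV gact1].
have -> : pull a k' w f = cls _ (tens_map (ract (stalk_mod W a) (k * k'^-1)%g)
    (ract F (k * k'^-1)%g) (tens (smap_to k^-1%g a w : stalk_mod W a) (ract F k^-1%g f))).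
  rewrite tens_mapE /pull /tens_over FM; [|exact/GSs/GV|exact/(stab_sub st)].
  rewrite /= (smap_to_comp SW) //; [|exact/GSs/GV|exact/(stab_sub st)|by case: st].
  by rewrite mulKg.
by rewrite coinv_rel_cls.
Qed.

(** As [(k * g^-1)^-1 = g * k^-1], the translation by [g] is absorbed into the element leading back
    to [a]. *)
Lemma pull_act (a : X) k g x (w : stalk W x) f : Gam k -> Gam g ->
  gact x g = gact a k ->
  pull a k (smap W g x w) (ract F g f) = pull a (k * g^-1)%g w f.
Proof.
have [[G1 GM GV] SS GSs _] := GS; have [F1 FM] := FS.
move=> Gk Gg xk; rewrite /pull invgM invgK FM; [|exact: GSs|exact/GSs/GV].
congr (tens_over _ _ _).
rewrite -(@smap_to_comp _ _ _ _ SW g k^-1%g x (gact x g)) //.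
- congr smap_to; rewrite /smap_to; case: pselect => // e.
  by rewrite (Prop_irrelevance e erefl).
- exact: GSs.
- exact/GSs/GV.
- by rewrite xk gactM mulgV gact1.
Qed.

Lemma orbit_rep_unique (a a' : A) k k' : Gam k -> Gam k' ->
  gact (sval a) k = gact (sval a') k' -> a = a'.
Proof.
move=> Gk Gk' e; have [b [_ bu]] := GA (gact (sval a) k).
apply: val_inj; change (sval a = sval a').
rewrite -(bu (sval a)) ?(bu (sval a')) //.
- by split; [exact/set_mem/(valP a')|exists k'].
- by split; [exact/set_mem/(valP a)|exists k].
Qed.

Lemma orbit_repP (x : X) : exists ak : A * G, Gam ak.2 /\ x = gact (sval ak.1) ak.2.
Proof.
by have [a [[Aa [k Gk xk]] _]] := GA x; exists (exist _ a (mem_set Aa), k).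
Qed.

(** In the direct sum, classes attached to different [a] have one type and can be compared before
    the representatives are known to agree. *)
Definition pull_in (a : A) k x (w : stalk W x) f : orbit_sum Gam W F A :=
  dsum_in (V := fun a : A => tensor_over (stab Gam (sval a)) (stalk_mod W (sval a)) F)
    (pull (sval a) k w f).

Lemma pull_in_indep (a a' : A) k k' x (w : stalk W x) f : Gam k -> Gam k' ->
  x = gact (sval a) k -> x = gact (sval a') k' -> pull_in a k w f = pull_in a' k' w f.
Proof.
move=> Gk Gk' xk xk'; have aa' : a = a' by apply: (orbit_rep_unique Gk Gk'); rewrite -xk.
by rewrite /pull_in; subst a'; rewrite (pull_indep _ _ Gk Gk' xk xk').
Qed.

Lemma sum_tensor_ext (U : zmodType) (f g : {additive tensor (sheaf_sum W) F -> U}) :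
  (forall x (w : stalk W x) n, f (tens (dsum_in w : sheaf_sum W) n) =
                               g (tens (dsum_in w : sheaf_sum W) n)) -> f =1 g.
Proof.
move=> fg; apply: tensor_ext => m n; move: m.
have t0 : tens (0 : sheaf_sum W) n = 0.
  by have := @tensBl (sheaf_sum W) F 0 0 n; rewrite !subrr.
apply: (@dsum_ind _ (stalk W) (fun m : sheaf_sum W => f (tens m n) = g (tens m n))).
- by rewrite t0 !raddf0.
- move=> x y fx fy.
  have -> : tens (x - y : sheaf_sum W) n = tens (x : sheaf_sum W) n - tens (y : sheaf_sum W) n.
    exact: (@tensBl (sheaf_sum W)).
  by rewrite !raddfB fx fy.
- by move=> x w; exact: fg.
Qed.

(** Each point gets a chosen representative and a chosen element of [Gam]; the resulting biadditive
    maps on stalks extend to the tensor product. Invariance under [Gam] and the formula for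
    arbitrary [k] both come from independence of the choice. *)
Lemma lambda_exists :
  exists lam : {additive tensor_over Gam (sheaf_sum W) F -> orbit_sum Gam W F A},
    is_lambda Gam W F A lam.
Proof.
have [rep repP] := choice orbit_repP.
have [[G1 GM GV] SS GSs _] := GS; have [F1 FM] := FS.
pose b x (w : stalk W x) f := pull_in (rep x).1 (rep x).2 w f.
have bl x f : zmod_morphism (fun w => b x w f).
  by move=> w w'; rewrite /b /pull_in pullBl raddfB.
have br x w : zmod_morphism (b x w).
  by move=> f f'; rewrite /b /pull_in pullBr raddfB.
pose bx x f := projT1 (cid (additive_exists (bl x f))).
have bxE x f : bx x f =1 b x ^~ f := projT2 (cid (additive_exists (bl x f))).
have [|m|t tE] := @tensor_lift (sheaf_sum W) F (orbit_sum Gam W F A)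
    (fun m f => dsum_lift (fun x => bx x f) m).
- by move=> f; exact: raddfB.
- move=> f f'; apply: (@dsum_ext _ _ _ (dsum_lift (bx^~ (f - f')))
    (dsum_lift (bx^~ f) \- dsum_lift (bx^~ f')) _ m) => x w.
  by rewrite /= !dsum_lift_in !bxE br.
have tin x (w : stalk W x) f : t (tens (dsum_in w : sheaf_sum W) f) = b x w f.
  by rewrite tE dsum_lift_in bxE.
have [|lam lamE] := @quot_lift _ _ (@coinv_rel G Gam (sheaf_sum W) F) t.
  move=> _ [k [v [Gk ->]]]; apply/eqP; rewrite raddfB subr_eq0; apply/eqP; move: v.
  apply: (@sum_tensor_ext _ (t \o tens_map (ract (sheaf_sum W) k) (ract F k)) t).
  move=> x w f; rewrite tin.
  transitivity (t (tens_map (ract (sheaf_sum W) k) (ract F k)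
    (tens (dsum_in w : sheaf_sum W) f))) => //.
  rewrite tens_mapE sheaf_sumE tin /b /pull_in.
  have [Gx ex] := repP x; have [Gy ey] := repP (gact x k).
  (* Both sides now start from [w] at [x]: one returns to [A] through the pair chosen for
     [gact x k], the other through the pair chosen for [x]. *)
  rewrite pull_act //; apply: pull_in_indep => //; first exact: GM (GV _ _).
  by rewrite -gactM -ey gactM mulgV gact1.
exists lam => a k w f Gk; rewrite lamE tin.
have [Gx ex] := repP (gact (sval a) k).
exact: pull_in_indep.
Qed.

(** For [a] in [A] this is the component of the inverse of lambda; on homology it induces
    [shapiro_in]. *)
Definition tens_in (a : X) :
    {additive tensor_over (stab Gam a) (stalk_mod W a) F ->
              tensor_over Gam (sheaf_sum W) F} :=
  tens_over_map (stab Gam a) Gam (dsum_in : {additive stalk_mod W a -> sheaf_sum W})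
    (idfun : {additive F -> F}).

Lemma tens_inE a (w : stalk_mod W a) f :
  tens_in a (tens_over (stab Gam a) w f) = tens_over Gam (dsum_in w : sheaf_sum W) f.
Proof.
apply: etrans (qmapE _ _) _; last exact: congr1 (tens_mapE _ _ _ _).
move=> _ [k [t [[Gk ak] ->]]]; rewrite raddfB; apply: cls_rel.
exists k, (tens_map (dsum_in : {additive stalk_mod W a -> sheaf_sum W}) idfun t).
split=> //; congr (_ - _).
apply: (@tensor_ext _ _ _
  (tens_map (dsum_in : {additive stalk_mod W a -> sheaf_sum W}) idfun \o
     tens_map (ract (stalk_mod W a) k) (ract F k))
  (tens_map (ract (sheaf_sum W) k) (ract F k) \o
     tens_map (dsum_in : {additive stalk_mod W a -> sheaf_sum W}) idfun)) => m n.
transitivity (tens_map (dsum_in : {additive stalk_mod W a -> sheaf_sum W})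
     (idfun : {additive F -> F})
     (tens_map (ract (stalk_mod W a) k) (ract F k) (tens m n))) => //.
by rewrite /= !tens_mapE /= ?tens_mapE sheaf_sumE -(dsum_in_smap_to m ak).
Qed.

Lemma tens_over_ext (K : set G) (M N : opmod G) (U : zmodType)
    (f g : {additive tensor_over K M N -> U}) :
  (forall m n, f (tens_over K m n) = g (tens_over K m n)) -> f =1 g.
Proof.
move=> fg c; have [v ->] := cls_surj c.
exact: (@tensor_ext _ _ _ (f \o cls _) (g \o cls _)).
Qed.

(** Every point is moved into [A] by an element of [Gam], and translating both factors by it does
    not change the class. *)
Lemma sum_tens_over_ext (U : zmodType)
    (f g : {additive tensor_over Gam (sheaf_sum W) F -> U}) :
  (forall (a : A) (w : stalk W (sval a)) n,
     f (tens_over Gam (dsum_in w : sheaf_sum W) n) =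
     g (tens_over Gam (dsum_in w : sheaf_sum W) n)) -> f =1 g.
Proof.
move=> fg c; have [v ->] := cls_surj c.
apply: (@sum_tensor_ext _ (f \o cls _) (g \o cls _)) => x w n.
have [[a k] [/= Gk xk]] := orbit_repP x; have [[_ _ GV] _ _ _] := GS.
have xkV : gact x k^-1%g = sval a by rewrite xk gactM mulgV gact1.
have -> : cls (@coinv_rel G Gam (sheaf_sum W) F) (tens (dsum_in w : sheaf_sum W) n) =
    tens_over Gam (dsum_in (smap_to k^-1%g (sval a) w) : sheaf_sum W) (ract F k^-1%g n).
  rewrite (dsum_in_smap_to w xkV) -sheaf_sumE /tens_over -(tens_mapE (ract (sheaf_sum W) _)).
  by rewrite coinv_rel_cls //; exact: GV.
exact: fg.
Qed.

Variable lam : {additive tensor_over Gam (sheaf_sum W) F -> orbit_sum Gam W F A}.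
Hypothesis lamP : is_lambda Gam W F A lam.

Lemma lambdaE (a : A) k x (w : stalk W x) f : Gam k -> x = gact (sval a) k ->
  lam (tens_over Gam (dsum_in w : sheaf_sum W) f) = pull_in a k w f.
Proof. by move=> Gk xk; subst x; exact: lamP. Qed.

Lemma lambda_stalk (a : A) (w : stalk_mod W (sval a)) f :
  lam (tens_over Gam (dsum_in w : sheaf_sum W) f) =
  dsum_in (tens_over (stab Gam (sval a)) w f).
Proof.
have [[G1 GM GV] SS GSs _] := GS; have [F1 FM] := FS.
have w1 : smap_to 1%g (sval a) w = w.
  have [W1 _] := SW; have := W1 _ w; rewrite (smap_toE w (gact1 (sval a))).
  exact: existT_inj2.
by rewrite (@lambdaE a 1%g) ?gact1 // /pull_in /pull invg1 F1 w1.
Qed.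

Lemma lambda_in (a : A) c : lam (tens_in (sval a) c) = dsum_in c.
Proof.
have [rhs rhsE] := additive_exists (@dsum_in_is_zmod_morphism _
  (fun a : A => tensor_over (stab Gam (sval a)) (stalk_mod W (sval a)) F) a).
rewrite -rhsE; apply: (@tens_over_ext _ _ _ (orbit_sum Gam W F A)
  (lam \o tens_in (sval a)) rhs) => w f.
by rewrite rhsE /= tens_inE lambda_stalk.
Qed.

Definition lambda_inv : orbit_sum Gam W F A -> tensor_over Gam (sheaf_sum W) F :=
  dsum_lift (fun a : A => tens_in (sval a)).

HB.instance Definition _ := GRing.Additive.on lambda_inv.

Lemma lambdaK : cancel lam lambda_inv.
Proof.
apply: (@sum_tens_over_ext _ (lambda_inv \o lam) idfun) => a w f.
transitivity (lambda_inv (lam (tens_over Gam (dsum_in w : sheaf_sum W) f))) => //.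
by rewrite lambda_stalk /lambda_inv dsum_lift_in tens_inE.
Qed.

Lemma lambda_invK : cancel lambda_inv lam.
Proof.
apply: (@dsum_ext _ _ _ (lam \o lambda_inv) idfun) => a c.
transitivity (lam (lambda_inv (dsum_in c))) => //.
by rewrite /lambda_inv dsum_lift_in lambda_in.
Qed.

Lemma lambda_bij : bijective lam.
Proof. by exists lambda_inv; [exact: lambdaK|exact: lambda_invK]. Qed.

(** By additivity [z] may be the class of a pure tensor with [w] over some [a] in [A], and then only
    this [a] contributes on the right. What remains is to compare a sum over cosets of [Gam] with
    one over cosets of [stab Gam (sval b)]. *)
Lemma lambda_hecke (h : G -> int) z (b : A) : hecke_fun Gam S h ->
  lam (hecke_op Gam S h z) b =
  \sum_(a \in [set: A]) hecke_entry_op Gam S h (sval a) (sval b) (lam z a).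
Proof.
move=> hH; have [sG SS GSs _] := GS; have [G1 GM GV] := sG; have [h0 hl hr _] := hH.
have SGam g k : S g -> Gam k -> S (g * k)%g by move=> ? /GSs; exact: SS.
have Sst (x : X) g k : S g -> stab Gam x k -> S (g * k)%g.
  by move=> Sg /(@stab_sub x); exact: SS.
have sb := stab_subgroup GS (sval b).
have cr := coset_repsP sG SGam; have cr' := coset_repsP sb (@Sst (sval b)).
have fin := coset_support_fin sG (hecke_support_fin GS hH) cr.
have [RS _] := cr; have [RS' _] := cr'.
pose rhs := dsum_lift (fun a : A =>
  (hecke_entry_op Gam S h (sval a) (sval b) :
     {additive tensor_over (stab Gam (sval a)) (stalk_mod W (sval a)) F ->
               tensor_over (stab Gam (sval b)) (stalk_mod W (sval b)) F})).
pose proj_b : {additive orbit_sum Gam W F A ->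
    tensor_over (stab Gam (sval b)) (stalk_mod W (sval b)) F} := @dsum_proj _
  (fun a : A => tensor_over (stab Gam (sval a)) (stalk_mod W (sval a)) F) b.
pose f1 : {additive tensor_over Gam (sheaf_sum W) F ->
    tensor_over (stab Gam (sval b)) (stalk_mod W (sval b)) F} :=
  proj_b \o (lam \o hecke_op Gam S h).
pose f2 : {additive tensor_over Gam (sheaf_sum W) F ->
    tensor_over (stab Gam (sval b)) (stalk_mod W (sval b)) F} := rhs \o lam.
apply: (@sum_tens_over_ext _ f1 f2) => a w f.
transitivity (lam (hecke_op Gam S h (tens_over Gam (dsum_in w : sheaf_sum W) f)) b) => //.
transitivity (rhs (lam (tens_over Gam (dsum_in w : sheaf_sum W) f))) => //.
rewrite lambda_stalk /rhs dsum_lift_in /=.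
rewrite (hecke_opE GS hH FS _ (sheaf_sum_module SW) cr).
have fin' := coset_support_fin sb (hecke_entry_support_fin GS hH (sval a) (sval b)) cr'.
rewrite (hecke_entry_opE GS hH FS _ SW cr').
(* [E] is a common summand for both sides; being constant on the cosets of [Gam] in [S], it can be
   evaluated at any representatives. *)
pose D g := lam (tens_over Gam (ract (sheaf_sum W) g (dsum_in w)) (ract F g f)) b.
pose E g := D g *~ h g.
have DM g k : S g -> Gam k -> D (g * k)%g = D g.
  move=> Sg Gk; have [_ MM] := sheaf_sum_module SW; have [_ FM] := FS.
  have Sk := GSs _ Gk.
  rewrite /D -MM // -FM // /tens_over -(tens_mapE (ract (sheaf_sum W) k) (ract F k)).
  by rewrite coinv_rel_cls.
have EM g k : S g -> Gam k -> E (g * k)%g = E g.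
  by move=> Sg Gk; rewrite /E DM // hr.
have Dstalk g : gact (sval a) g = sval b ->
    D g = tens_over (stab Gam (sval b))
      (smap_to g (sval b) w : stalk_mod W (sval b)) (ract F g f).
  move=> ag; rewrite /D sheaf_sumE -(dsum_in_smap_to w ag).
  by rewrite (lambda_stalk (a := b)) dsum_in_same.
(* A nonzero component at [b] forces [gact (sval a) g] into the orbit of [b], so some element of the
   coset of [g] moves [a] to [b]. *)
have Dsupp g : S g -> D g != 0 -> exists2 k, Gam k & gact (sval a) (g * k)%g = sval b.
  move=> Sg; have [[a' k] [/= Gk xk]] := orbit_repP (gact (sval a) g).
  rewrite /D sheaf_sumE (@lambdaE a' k) // /pull_in.
  have [<- _|nab] := eqVneq a' b; last by rewrite dsum_in_diff ?eqxx.
  by exists k^-1%g; [exact: GV|rewrite -gactM xk gactM mulgV gact1].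
transitivity (\sum_(g \in coset_reps Gam S `&` [set g | h g != 0]) E g : tensor_over _ _ _).
  rewrite fsbig_finite //.
  transitivity (\sum_(g <- fset_set (coset_reps Gam S `&` [set g | h g != 0]))
     proj_b (lam (cls _ (tens_map (ract (sheaf_sum W) g) (ract F g)
       (tens (dsum_in w : sheaf_sum W) f) *~ h g)))); first by rewrite -!raddf_sum.
  by apply: eq_bigr => g _; rewrite !raddfMz tens_mapE.
transitivity (\sum_(t \in coset_reps (stab Gam (sval b)) S `&`
    [set t | hecke_entry h (sval a) (sval b) t != 0]) E t); last first.
  rewrite fsbig_finite // raddf_sum; apply: eq_big_seq => t.
  rewrite in_fset_set // inE => -[/RS' St /hecke_entryP[at_ ht]].
  by rewrite raddfMz tens_mapE /E Dstalk // /hecke_entry at_ eqxx.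
(* Each [t] is replaced by the chosen representative of its coset of [Gam], so that the sum can be
   reindexed over a subset of the other index set. *)
transitivity (\sum_(t \in coset_reps (stab Gam (sval b)) S `&`
    [set t | hecke_entry h (sval a) (sval b) t != 0]) E (coset_rep Gam t)); last first.
  apply: eq_fsbigr => t /set_mem[/RS' St _].
  by have [k Gk <-] := coset_repP t sG; exact: EM.
(* Injectivity: if [t] and [t'] lie in one coset of [Gam] and both move [a] to [b], they differ by
   an element of [Gam] fixing [b]. *)
rewrite -[RHS]fsbig_image; last first.
  move=> t t'; rewrite !inE => -[Rt /hecke_entryP[at_ _]] [Rt' /hecke_entryP[at' _]] e.
  apply: (coset_reps_inj sb cr' Rt Rt').
  have [k Gk tk] : left_coset t' Gam t.
    rewrite -(left_cosetP sG (coset_repP t' sG)) -e (left_cosetP sG (coset_repP t sG)).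
    exact: left_coset_refl.
  apply: left_cosetP => //; exists k => //; split=> //.
  by rewrite -{1}at' gactM tk.
apply/esym/fsbig_widen.
  move=> _ [t [/RS' St /hecke_entryP[at_ ht]] <-]; split; first by exists t.
  by have [k Gk <-] := coset_repP t sG; rewrite /= hr.
(* The indices outside the image contribute zero: if [E g] is nonzero, a preimage of [g] is
   found. *)
move=> g [[Rg hg] gn]; apply/eqP; apply: contra_notT gn => Eg.
have Sg := RS _ Rg.
have [|k Gk agk] := Dsupp g Sg.
  by apply/eqP => D0; move: Eg; rewrite /E D0 mul0rz eqxx.
(* The preimage is the representative of [g * k] modulo the stabilizer of [b]; it still moves [a] to
   [b] and lies in the coset of [g]. *)
have [l [Gl bl] tl] := coset_repP (g * k)%g sb.
exists (coset_rep (stab Gam (sval b)) (g * k)%g); last first.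
  rewrite -tl !coset_rep_mulr //; have [g0 _ <-] := Rg.
  exact: coset_rep_eq (coset_repP g0 sG).
split; first by exists (g * k)%g => //; exact: SGam.
rewrite /= -tl /hecke_entry -gactM agk bl eqxx hr ?hr //; exact: SGam.
Qed.

End Coefficients.

End Lambda.

(** * Coinduction, and restriction of projective modules to a subgroup *)

Section Coinduced.
Variables (G : groupType) (H : set G).
Hypothesis sH : subgroup H.

Section Module.
Variable M : opmod G.

(** These are the homomorphisms of right [H]-modules from Z[G] to [M]. Taking functions on all of
    [G] lets every element of [G] operate by left translation of the argument. *)
Definition coind_pred : {pred G -> M} :=
  fun u => `[< forall x k, H k -> u (x * k)%g = ract M k (u x) >].

Fact coind_zmod : zmod_closed coind_pred.
Proof.
split=> [|u v /asboolP hu /asboolP hv]; apply/asboolP => x k Hk.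
  by rewrite raddf0.
by rewrite raddfB -hu // -hv.
Qed.

HB.instance Definition _ := GRing.isZmodClosed.Build (G -> M) coind_pred coind_zmod.

Definition coind := {u : G -> M | u \in coind_pred}.
HB.instance Definition _ := SubChoice.on coind.
HB.instance Definition _ := [SubChoice_isSubZmodule of coind by <:].

Lemma coind_mul (u : coind) x k : H k -> val u (x * k)%g = ract M k (val u x).
Proof. by move: (valP u) => /asboolP; apply. Qed.

Fact coind_act_subproof g (u : coind) : (fun x => val u (g * x)%g) \in coind_pred.
Proof. by apply/asboolP => x k Hk /=; rewrite mulgA coind_mul. Qed.

Definition coind_act g (u : coind) : coind :=
  exist (fun u => u \in coind_pred) _ (coind_act_subproof g u).

Fact coind_act_zmod g : zmod_morphism (coind_act g).
Proof. by move=> u v; apply: val_inj. Qed.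

HB.instance Definition _ g :=
  GRing.isZmodMorphism.Build _ _ (coind_act g) (coind_act_zmod g).

Definition coind_mod : opmod G := OpMod coind_act.

Lemma coind_module (K : set G) : is_right_module K coind_mod.
Proof.
split=> [u|g h _ _ u]; apply: val_inj; apply/funext => x /=.
  by rewrite mul1g.
by rewrite mulgA.
Qed.

End Module.

(* An H-map P -> N extends to a K-map from P to the module coinduced from N, by
   sending m to x |-> f (mx); it is set to 0 for x outside K, where the operation
   on P is arbitrary. *)
Lemma projective_sub (K : set G) (P : opmod G) : subgroup K -> H `<=` K ->
  is_right_module K P -> projective K P -> projective H P.
Proof.
move=> [K1 KM KV] HK [P1 PM] Pproj M N p f [M1 MM] [N1 NM] pH fH psurj.
have [H1 HM HV] := sH.
have [pp ppE] : exists pp : {additive coind_mod M -> coind_mod N},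
    forall u x, val (pp u) x = p (val u x).
  have pu (u : coind M) : (fun x => p (val u x)) \in coind_pred (M := N).
    by apply/asboolP => x k Hk; rewrite coind_mul // pH.
  have [|g gE] := @additive_exists (coind M) (coind N)
      (fun u => exist (fun u => u \in coind_pred (M := N)) _ (pu u)).
    move=> u v; apply: val_inj; apply/funext => x.
    change (p (val u x - val v x) = p (val u x) - p (val v x)); exact: raddfB.
  by exists g => u x; rewrite gE.
have [ff ffE] : exists ff : {additive P -> coind_mod N},
    forall m x, val (ff m) x = if x \in K then f (ract P x m) else 0.
  have fu m : (fun x => if x \in K then f (ract P x m) else 0) \in coind_pred (M := N).
    apply/asboolP => x k Hk; have Kk := HK _ Hk.
    (* Membership in [K] is constant on left cosets of [H], so extension by zero respects the
       coinduction condition. *)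
    have -> : ((x * k)%g \in K) = (x \in K).
      apply/idP/idP; rewrite !inE => Kx; last exact: KM.
      by rewrite -(mulgK k x); apply: KM => //; exact: KV.
    by case: ifPn => [/set_mem Kx|_]; [rewrite -PM // fH|rewrite raddf0].
  have [|g gE] := @additive_exists P (coind N)
      (fun m => exist (fun u => u \in coind_pred (M := N)) _ (fu m)).
    move=> u v; apply: val_inj; apply/funext => x /=.
    change ((if x \in K then f (ract P x (u - v)) else 0) =
      (if x \in K then f (ract P x u) else 0) - (if x \in K then f (ract P x v) else 0)).
    by case: ifP => _; rewrite ?subr0 // !raddfB.
  by exists g => u x; rewrite gE.
have [||u|f' f'K f'E] := Pproj _ _ pp ff (coind_module M K) (coind_module N K).
- by move=> g _ u; apply: val_inj; apply/funext => x; rewrite ppE /= ppE.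
- move=> g Kg m; apply: val_inj; apply/funext => x; rewrite ffE /= ffE.
  have -> : ((g * x)%g \in K) = (x \in K).
    apply/idP/idP; rewrite !inE => Kx; last exact: KM.
    by rewrite -(mulKg g x); apply: KM => //; exact: KV.
  by case: ifPn => [/set_mem Kx|//]; rewrite PM.
(* Surjectivity of [pp]: the values of [u] at coset representatives are lifted through [p], and the
   lifts are spread over each coset by the operation of [H]. *)
- have [s sE] := choice psurj.
  pose r x := coset_rep H x.
  pose v x := ract M ((r x)^-1 * x)%g (s (val u (r x))).
  have rH x : H ((r x)^-1 * x)%g.
    by have [k Hk e] := coset_repP x sH; rewrite /r -e invgM -mulgA mulVg mulg1; exact: HV.
  have vH : v \in coind_pred (M := M).
    apply/asboolP => x k Hk; rewrite /v MM //.
    by rewrite /r coset_rep_mulr // mulgA.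
  exists (exist (fun u => u \in coind_pred (M := M)) v vH); apply: val_inj; apply/funext => x.
  by rewrite ppE /= /v pH // sE -coind_mul // mulVKg.
(* Evaluation at 1 is the counit of the adjunction. It is [H]-equivariant since the translate of [u]
   by [k] takes at 1 the value of [u] at [k]. *)
pose ev1 (u : coind M) := val u 1%g.
have [|f1 f1E] := @additive_exists P M (fun m => ev1 (f' m)).
  by move=> m m'; rewrite raddfB.
exists f1 => [k Hk m|m].
  by rewrite !f1E f'K ?/ev1 /= ?mulg1 -?coind_mul ?mul1g //; exact: HK.
by rewrite f1E /ev1 -ppE f'E ffE mem_set // P1.
Qed.

End Coinduced.

(** * Maps induced on cycles and homology by chain maps *)

Section ChainMap.
Variables (C D : zcomplex) (f : forall n, {additive C n -> D n}).
Hypothesis fd : forall n x, f n (zd C n x) = zd D n (f n.+1 x).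

Lemma cycle_map_subproof q (z : Defs.cycle C q) : f q (val z) \in @cycles D q.
Proof.
move: (valP z); move: (val z); case: q {z} => // n x.
by rewrite !unfold_in /= => /eqP dx; rewrite -fd dx raddf0.
Qed.

Definition cycle_map q (z : Defs.cycle C q) : Defs.cycle D q :=
  exist (fun x => x \in @cycles D q) _ (cycle_map_subproof z).

Lemma hmap_hcls q (z : Defs.cycle C q) : hmap (f q) (hcls z) = hcls (cycle_map z).
Proof. exact: hmapE. Qed.

Fact cycle_map_zmod q : zmod_morphism (@cycle_map q).
Proof. by move=> x y; apply: val_inj; exact: raddfB. Qed.

HB.instance Definition _ q :=
  GRing.isZmodMorphism.Build _ _ (@cycle_map q) (@cycle_map_zmod q).

(** [hmap] is defined through chosen representatives; the chain map condition makes it independent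
    of them and hence additive. *)
Lemma hmap_additive q :
  exists g : {additive homology C q -> homology D q}, g =1 hmap (f q).
Proof.
apply: additive_exists => c d; have [v ->] := cls_surj c; have [w ->] := cls_surj d.
by rewrite -raddfB !hmap_hcls /hcls !raddfB.
Qed.

End ChainMap.

(** * Lambda on homology and Shapiro's lemma *)

Section LambdaHomology.
Variables (G : groupType) (Gam S : set G) (X : gset G) (W : sheaf X) (A : set X).
Variable F : opcomplex G.
Hypothesis GS : hecke_pair Gam S.
Hypothesis SW : is_sheaf S W.
Hypothesis GA : orbit_reps Gam A.
Hypothesis FS : equivariant_complex S F.

Local Notation stalk_tensor n :=
  (fun a : A => tensor_over (stab Gam (sval a)) (stalk_mod W (sval a)) (F n)).
Local Notation sum_complex := (tensor_complex Gam (sheaf_sum W) F).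
Local Notation stalk_complex a :=
  (tensor_complex (stab Gam (sval a)) (stalk_mod W (sval a)) F).
Local Notation stalk_homology q :=
  (fun a : A => ghomology (stab Gam (sval a)) (stalk_mod W (sval a)) F q).

Lemma tens_over_d (K : set G) (M : opmod G) n m f : K `<=` S ->
  zd (tensor_complex K M F) n (tens_over K m f) = tens_over K m (ocd F n f).
Proof.
by move=> KS; apply: etrans (tens_over_mapE FS _ KS) _; exact: congr1 (tens_mapE _ _ _ _).
Qed.

Definition tens_in_comp (a : A) n : {additive stalk_complex a n -> sum_complex n} :=
  tens_in Gam W (F n) (sval a).

Lemma tens_in_d (a : A) n c :
  tens_in_comp a n (zd (stalk_complex a) n c) = zd sum_complex n (tens_in_comp a n.+1 c).
Proof.
have [_ _ GSs _] := GS.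
have stS := @stab_sub _ _ _ X GS (sval a).
apply: (@tens_over_ext _ _ _ _ _ (tens_in Gam W (F n) (sval a) \o zd (stalk_complex a) n)
  (zd sum_complex n \o tens_in Gam W (F n.+1) (sval a))) => w f.
transitivity (tens_in Gam W (F n) (sval a) (zd (stalk_complex a) n
  (tens_over (stab Gam (sval a)) (w : stalk_mod W (sval a)) f))) => //.
transitivity (zd sum_complex n (tens_in Gam W (F n.+1) (sval a)
  (tens_over (stab Gam (sval a)) (w : stalk_mod W (sval a)) f))) => //.
by rewrite tens_over_d // !tens_inE tens_over_d.
Qed.

Variable lam : forall q,
  {additive tensor_over Gam (sheaf_sum W) (F q) -> orbit_sum Gam W (F q) A}.
Hypothesis lamP : forall q, is_lambda Gam W (F q) A (lam q).

Let FM n : is_right_module S (F n). Proof. by have [] := FS. Qed.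

Definition lambda_comp (a : A) n : {additive sum_complex n -> stalk_complex a n} :=
  @dsum_proj _ (stalk_tensor n) a \o lam n.

(** On the generating stalks over [A], lambda is the inclusion of a summand, and the boundary
    affects only the factor from the resolution. *)
Lemma lambda_d (a : A) n c :
  lambda_comp a n (zd sum_complex n c) = zd (stalk_complex a) n (lambda_comp a n.+1 c).
Proof.
have [_ _ GSs _] := GS.
apply: (@sum_tens_over_ext _ _ _ _ _ _ GS GA _ _ (lambda_comp a n \o zd sum_complex n)
  (zd (stalk_complex a) n \o lambda_comp a n.+1)) => a0 w f.
transitivity (lam n (zd sum_complex n (tens_over Gam (dsum_in w : sheaf_sum W) f)) a) => //.
transitivity (zd (stalk_complex a) n
  (lam n.+1 (tens_over Gam (dsum_in w : sheaf_sum W) f) a)) => //.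
rewrite tens_over_d // !(lambda_stalk GS SW (FM _) (@lamP _)).
have [<-|na] := eqVneq a0 a.
  by rewrite !dsum_in_same tens_over_d //; exact: stab_sub.
by rewrite !dsum_in_diff // raddf0.
Qed.

Section Degree.
Variable q : nat.

Lemma lambda_homology_fin (c : ghomology Gam (sheaf_sum W) F q) :
  finite_set [set a | (hmap (lambda_comp a q) c : stalk_homology q a) != 0].
Proof.
have [z ->] := cls_surj c.
apply: sub_finite_set (dsum_fin (lam q (val z))) => a /=; apply: contra_neq => z0.
rewrite -/(hcls z) (hmap_hcls (@lambda_d a)).
have -> : cycle_map (@lambda_d a) z = 0 by apply: val_inj.
exact: raddf0.
Qed.

(** Assembling the map from components, each a chain map, avoids forming the homology of a direct
    sum of complexes. *)
Definition lambda_homology_fun (c : ghomology Gam (sheaf_sum W) F q) :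
  orbit_homology Gam W F q A := DSum (lambda_homology_fin c).

Fact lambda_homology_zmod : zmod_morphism lambda_homology_fun.
Proof.
move=> c d; apply: dsumP => a.
change (hmap (lambda_comp a q) (c - d) = hmap (lambda_comp a q) c - hmap (lambda_comp a q) d).
by have [g gE] := hmap_additive (@lambda_d a) q; rewrite -!gE raddfB.
Qed.

HB.instance Definition _ :=
  GRing.isZmodMorphism.Build _ _ lambda_homology_fun lambda_homology_zmod.

Lemma lambda_homologyE (z : Defs.cycle sum_complex q) (a : A) :
  lambda_homology_fun (hcls z) a = hcls (cycle_map (@lambda_d a) z).
Proof. exact: (hmap_hcls (@lambda_d a)). Qed.

Lemma lambda_homology_induced : induced_on_homology (lam q) lambda_homology_fun.
Proof.
by move=> z a; exists (cycle_map (@lambda_d a) z) => //; exact: lambda_homologyE.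
Qed.

(** The support of lambda at the cycle contains that of its homology classes, so one finite index
    set serves both on chains and in homology. *)
Lemma lambda_homology_lift (U : zmodType)
    (f : forall a : A, {additive stalk_homology q a -> U}) (z : Defs.cycle sum_complex q) :
  dsum_lift (V := stalk_homology q) f (lambda_homology_fun (hcls z)) =
  \sum_(a <- fset_set [set a | lam q (val z) a != 0])
    f a (hcls (cycle_map (@lambda_d a) z)).
Proof.
apply: etrans (dsum_liftE _ (dsum_fin (lam q (val z))) _) _.
  move=> a; apply: contra_neq => z0; rewrite lambda_homologyE.
  have -> : cycle_map (@lambda_d a) z = 0 by apply: val_inj.
  exact: raddf0.
by apply: eq_bigr => a _; rewrite lambda_homologyE.
Qed.

Lemma shapiro_inE (a : A) (z : Defs.cycle (stalk_complex a) q) :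
  shapiro_in Gam (sval a) (hcls z) = hcls (cycle_map (@tens_in_d a) z).
Proof. exact: (hmap_hcls (@tens_in_d a)). Qed.

Lemma lambda_homology_shapiro_in (a : A) (c : stalk_homology q a) :
  lambda_homology_fun (shapiro_in Gam (sval a) c) = dsum_in (V := stalk_homology q) c.
Proof.
have [z ->] := cls_surj c; rewrite -/(hcls z) shapiro_inE; apply: dsumP => b.
rewrite lambda_homologyE.
have lz : val (cycle_map (@lambda_d b) (cycle_map (@tens_in_d a) z)) =
    dsum_in (V := stalk_tensor q) (val z) b.
  transitivity (lam q (tens_in Gam W (F q) (sval a) (val z)) b) => //.
  by rewrite (lambda_in GS SW (FM _) (@lamP _)).
have [ab|nab] := eqVneq a b.
  subst b; rewrite dsum_in_same; congr hcls; apply: val_inj.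
  by rewrite lz dsum_in_same.
rewrite dsum_in_diff //.
have -> : cycle_map (@lambda_d b) (cycle_map (@tens_in_d a) z) = 0.
  by apply: val_inj; rewrite lz dsum_in_diff.
exact: raddf0.
Qed.

Lemma lambda_homology_shapiro : shapiro_iso lambda_homology_fun.
Proof.
split; last exact: lambda_homology_shapiro_in.
(* [shapiro_in] is bundled as an additive map so that [dsum_lift] applies; the lift is the
   inverse. *)
pose sh (a : A) := projT1 (cid (hmap_additive (@tens_in_d a) q)).
have shE a : sh a =1 shapiro_in Gam (sval a) := projT2 (cid (hmap_additive (@tens_in_d a) q)).
exists (dsum_lift (V := stalk_homology q) sh) => [c|].
  have [z ->] := cls_surj c; rewrite -/(hcls z).
  apply: etrans (lambda_homology_lift sh z) _.
  transitivity (hcls (\sum_(a <- fset_set [set a | lam q (val z) a != 0])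
      cycle_map (@tens_in_d a) (cycle_map (@lambda_d a) z))).
    rewrite /hcls raddf_sum; apply: eq_bigr => a _.
    by rewrite shE shapiro_inE.
  congr hcls; apply: val_inj; rewrite raddf_sum /=.
  (* The sum is the inverse of lambda applied to lambda of the cycle, written over the support of
     the latter. *)
  rewrite -[RHS](lambdaK GS SW GA (FM _) (@lamP q)).
  exact/esym/(dsum_liftE _ (dsum_fin (lam q (val z)))).
apply: (@dsum_ext _ (stalk_homology q) (orbit_homology Gam W F q A)
  (lambda_homology_fun \o dsum_lift (V := stalk_homology q) sh) idfun) => a c.
transitivity (lambda_homology_fun (dsum_lift (V := stalk_homology q) sh
  (dsum_in (V := stalk_homology q) c))) => //.
by rewrite dsum_lift_in shE lambda_homology_shapiro_in.
Qed.

Lemma lambda_homology_hecke (h : G -> int) c (b : A) : hecke_fun Gam S h ->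
  lambda_homology_fun (hecke_homology Gam S h c) b =
  \sum_(a \in [set: A])
    hecke_entry_homology Gam S h (sval a) (sval b) (lambda_homology_fun c a).
Proof.
move=> hH; have MS := sheaf_sum_module SW.
pose hop n : {additive sum_complex n -> sum_complex n} := hecke_op Gam S h.
have hop_d n x : hop n (zd sum_complex n x) = zd sum_complex n (hop n.+1 x).
  exact: (hecke_op_d GS hH FS _ MS).
pose hen (a : A) n : {additive stalk_complex a n -> stalk_complex b n} :=
  hecke_entry_op Gam S h (sval a) (sval b).
have hen_d a n x : hen a n (zd (stalk_complex a) n x) = zd (stalk_complex b) n (hen a n.+1 x).
  exact: (hecke_entry_op_d GS hH FS _ _ SW).
have hopE (z : Defs.cycle sum_complex q) :
  hecke_homology Gam S h (hcls z) = hcls (cycle_map hop_d z) := hmap_hcls hop_d z.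
have henE a (z : Defs.cycle (stalk_complex a) q) :
  hecke_entry_homology Gam S h (sval a) (sval b) (hcls z) = hcls (cycle_map (hen_d a) z) :=
  hmap_hcls (hen_d a) z.
have [z ->] := cls_surj c; rewrite -/(hcls z) hopE lambda_homologyE.
pose T (a : A) := projT1 (cid (hmap_additive (hen_d a) q)).
have TE a : T a =1 hecke_entry_homology Gam S h (sval a) (sval b) :=
  projT2 (cid (hmap_additive (hen_d a) q)).
transitivity (dsum_lift (V := stalk_homology q) T (lambda_homology_fun (hcls z))); last first.
  by apply: eq_fsbigr => a _; exact: TE.
apply/esym/(etrans (lambda_homology_lift T z)).
transitivity (hcls (\sum_(a <- fset_set [set a | lam q (val z) a != 0])
    cycle_map (hen_d a) (cycle_map (@lambda_d a) z))).
  rewrite /hcls raddf_sum; apply: eq_bigr => a _.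
  exact: etrans (TE _ _) (henE _ _).
(* The two cycles are equal, not merely homologous, by the matrix formula on coinvariants in degree
   [q]. *)
congr hcls; apply: val_inj; rewrite raddf_sum /=; apply: esym.
transitivity (lam q (hecke_op Gam S h (val z)) b) => //.
rewrite (lambda_hecke GS SW GA (FM _) (@lamP q) _ _ hH).
exact: (@dsum_liftE _ (stalk_tensor q) _
  (fun a => hecke_entry_op Gam S h (sval a) (sval b)) _ _ (dsum_fin (lam q (val z)))).
Qed.

End Degree.

End LambdaHomology.

Theorem theorem3p1 (G : groupType) (Gam S : set G) (X : gset G) (W : sheaf X)
    (A : set X) :
  hecke_pair Gam S -> is_sheaf S W -> orbit_reps Gam A ->
  (forall F : opmod G, is_right_module S F ->
    (exists lam : {additive tensor_over Gam (sheaf_sum W) F ->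
                            orbit_sum Gam W F A},
       is_lambda Gam W F A lam) /\
    (forall lam : {additive tensor_over Gam (sheaf_sum W) F ->
                            orbit_sum Gam W F A},
       is_lambda Gam W F A lam ->
       bijective lam /\
       forall h : G -> int, hecke_fun Gam S h ->
       forall (z : tensor_over Gam (sheaf_sum W) F) (b : A),
         lam (hecke_op Gam S h z) b =
         \sum_(a \in [set: A]) hecke_entry_op Gam S h (sval a) (sval b) (lam z a)))
  /\
  (forall F : opcomplex G,
     equivariant_complex S F -> projective_resolution Gam F ->
     (forall a : A, projective_resolution (stab Gam (sval a)) F) /\
     forall lam : forall q, {additive tensor_over Gam (sheaf_sum W) (F q) ->
                                      orbit_sum Gam W (F q) A},
     (forall q, is_lambda Gam W (F q) A (lam q)) ->
     forall q,
     exists Lam : {additive ghomology Gam (sheaf_sum W) F q ->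
                            orbit_homology Gam W F q A},
     [/\ induced_on_homology (lam q) Lam,
         shapiro_iso Lam &
         forall h : G -> int, hecke_fun Gam S h ->
         forall (z : ghomology Gam (sheaf_sum W) F q) (b : A),
           Lam (hecke_homology Gam S h z) b =
           \sum_(a \in [set: A])
             hecke_entry_homology Gam S h (sval a) (sval b) (Lam z a)]).
Proof.
move=> GS SW GA; have [sG _ GSs _] := GS; split=> [F FS|F FS [FG Fres Fproj]].
  split=> [|lam lamP]; first exact: (lambda_exists GS SW GA FS).
  split=> [|h hH z b]; first exact: (lambda_bij GS SW GA FS lamP).
  exact: (lambda_hecke GS SW GA FS lamP z b hH).
split=> [a|lam lamP q].
  (* Exactness does not involve the group and equivariance restricts to the stabilizer, so only
     projectivity calls for coinduction. *)
  have stG : stab Gam (sval a) `<=` Gam by move=> g [].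
  have [FM dG augG] := FG; split=> //; last first.
    by move=> n; exact: (projective_sub (stab_subgroup GS (sval a)) sG stG (FM n) (Fproj n)).
  split=> [n|n g /stG|g /stG]; [|exact: dG|exact: augG].
  by have [F1 FM'] := FM n; split=> // g k /stG Gg /stG Gk; exact: FM'.
exists (lambda_homology_fun GS SW GA FS lamP (q := q)); split.
- exact: lambda_homology_induced.
- exact: lambda_homology_shapiro.
- by move=> h hH z b; exact: lambda_homology_hecke.
Qed.
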